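(* Let $N\ge n\ge 1$ be integers and let $G$ be an $n\times N$ complex random matrix with i.i.d. complex normally distributed entries with mean $0$ and variance $n^{-1}$. Let $R=R_D+G$, where $R_D\in\mathbb C^{n\times N}$ is a deterministic matrix. Then, for every $\tau>0$, $$\mathbb P\left(\sigma_n(R)\le\tau\right)\le\frac{\tau^{2(N-n+1)}}{\sqrt{2\pi}}\;\frac{(nNe^2)^{N-n+1}}{(N-n+1)^{2(N-n+1)+1/2}}.$$
   Context: A complex normal random variable with mean $0$ and variance $v$ is circularly symmetric: its real and imaginary parts are independent real $\mathcal N(0,v/2)$ variables. The singular values of an $n\times N$ matrix $R$ with $N\ge n$ are denoted $\sigma_1(R)\ge\dots\ge\sigma_n(R)\ge0$, so $\sigma_n(R)$ is the smallest one. *)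

(* Defs.v *)
From HB Require Import structures.
From mathcomp Require Import all_boot all_order all_algebra.
From mathcomp Require Import all_classical all_reals all_analysis.
From mathcomp Require Import complex.

Set Implicit Arguments.
Unset Strict Implicit.
Unset Printing Implicit Defensive.

Import Order.TTheory GRing.Theory Num.Theory.

Local Open Scope classical_set_scope.
Local Open Scope ring_scope.
Local Open Scope sesquilinear_scope.

(* The square roots of the eigenvalues of [A A^*], with multiplicity, in
   nonincreasing order.  As [A A^*] is hermitian positive semidefinite,
   [spectral_diag] lists its eigenvalues and they are real and nonnegative,
   so taking real parts loses nothing.  There are [n] of them, which is the
   usual number of singular values of an [n x N] matrix when [n <= N]. *)
Definition singular_values (R : realType) (n N : nat) (A : 'M[R[i]]_(n, N)) :
    seq R :=
  sort >=%R [seq Num.sqrt (complex.Re (spectral_diag (A *m A^t*) ord0 i))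
            | i <- enum 'I_n].

(* Numbered from 1: [singular_value A 1] is the largest one and
   [singular_value A n] the smallest one. *)
Definition singular_value (R : realType) (n N : nat) (A : 'M[R[i]]_(n, N))
    (k : nat) : R :=
  (singular_values A)`_k.-1.

(* Since [B i] may be the full space, the product rule for the whole finite
   family contains the product rule for each of its subfamilies. *)
Definition mutually_independent (d d' : measure_display)
    (T : measurableType d) (E : measurableType d') (R : realType)
    (P : probability T R) (I : finType) (X : I -> T -> E) : Prop :=
  forall B : I -> set E, (forall i, measurable (B i)) ->
    P (\bigcap_(i in [set: I]) (X i @^-1` B i)) =
    (\prod_(i : I) P (X i @^-1` B i))%E.

Definition independent_pair (d d1 d2 : measure_display)
    (T : measurableType d) (E1 : measurableType d1) (E2 : measurableType d2)
    (R : realType) (P : probability T R) (X : T -> E1) (Y : T -> E2) : Prop :=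
  forall (A : set E1) (B : set E2), measurable A -> measurable B ->
    P ((X @^-1` A) `&` (Y @^-1` B)) = (P (X @^-1` A) * P (Y @^-1` B))%E.

(* [normal_prob] takes the standard deviation as its second parameter. *)
Definition real_normal (d : measure_display) (T : measurableType d)
    (R : realType) (P : probability T R) (X : T -> R) (m v : R) : Prop :=
  measurable_fun [set: T] X /\
  forall B : set R, measurable B ->
    pushforward P X B = normal_prob m (Num.sqrt v) B.

(* Circularly symmetric, with mean 0 and variance [v]. *)
Definition complex_normal (d : measure_display) (T : measurableType d)
    (R : realType) (P : probability T R) (Z : T -> R[i]) (v : R) : Prop :=
  [/\ real_normal P (fun t => complex.Re (Z t)) 0 (v / 2),
      real_normal P (fun t => complex.Im (Z t)) 0 (v / 2) &
      independent_pair P (fun t => complex.Re (Z t))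
                         (fun t => complex.Im (Z t))].

(* [R[i]] carries no measurable structure in the library; its Borel
   sigma-algebra is that of [R * R] through this identification. *)
Definition re_im (R : realType) (z : R[i]) : R * R :=
  (complex.Re z, complex.Im z).

(* Independent entries, each complex normal with mean 0 and variance [v]. *)
Definition iid_complex_normal_matrix (d : measure_display)
    (T : measurableType d) (R : realType) (P : probability T R) (n N : nat)
    (G : T -> 'M[R[i]]_(n, N)) (v : R) : Prop :=
  (forall i j, complex_normal P (fun t => G t i j) v) /\
  mutually_independent P
    (fun (ij : 'I_n * 'I_N) (t : T) => re_im (G t ij.1 ij.2)).

(* Main.v *)
Require Import Defs.
From HB Require Import structures.
From mathcomp Require Import all_boot all_order all_algebra.
From mathcomp Require Import measurable_realfun.
From mathcomp Require Import all_classical all_reals all_analysis.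
From mathcomp Require Import complex ring lra.

Set Implicit Arguments.
Unset Strict Implicit.
Unset Printing Implicit Defensive.

Import Order.TTheory GRing.Theory Num.Theory.
Import numFieldNormedType.Exports.

Local Open Scope classical_set_scope.
Local Open Scope ring_scope.
Local Open Scope sesquilinear_scope.

(* Realise an independent copy of [G] on a product space and let [g] be its first
   column.  If [|y R| < tau |y|] for some row vector [y], then, given [R], with
   probability at least [(1 - kappa)^(n-1)] we have [|y g|^2 > kappa |g|^2 |y|^2].
   By unitary invariance [g] may be rotated to a multiple of the first basis vector;
   then the first row of the rotated [R] is at distance less than
   [tau / sqrt kappa] from the span of the other rows.  Given these, that distance
   is the norm of a noncentred Gaussian vector with at least [k = N - n + 1]
   complex coordinates, so this has probability at most
   [(n tau^2 / kappa)^k / k!].  Taking [kappa = k / N] costs a factor at most [e^k],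
   which gives [(n N e tau^2 / k)^k / k!], and Stirling's lower bound for [k!]
   yields the constant of the theorem.

   Unitary invariance is obtained from Givens rotations, which are products of
   three complex shears.  The Stirling bound comes from
   [binom(2k, k) <= 4^k / sqrt (pi k)], which says that the ratio [b_k] of [k!] to
   its Stirling approximation satisfies [b_(2k) <= b_k^2]. *)

(** The row vector [y] that [R] nearly annihilates depends on [R], so unitary invariance cannot
    rotate it to a fixed direction; picking instead a coordinate where [y] is large would cost a
    union bound over the rows. The independent column [g] avoids both: one event on the product
    space is measured twice by Tonelli. With [R] frozen, a witness [y] is fixed and the law of [g]
    gives a lower bound; with [g] frozen, the direction is deterministic and the law of [R] gives an
    upper bound.

    The deterministic part of [R] is harmless because the Gaussian density is only bounded by its
    maximum [1 / (pi v)], and the volume of a ball does not depend on its centre.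

    In the constant, [n] is the inverse variance and [N / k] the inverse of [kappa]. One factor
    [e^k] pays for the event about [g]; the other one, with the second [k^-k] and with
    [1 / sqrt (2 pi k)], comes from Stirling's bound. *)

(** * Independent families and partial resampling *)

Definition iid d d' (T : measurableType d) (E : measurableType d')
    (R : realType) (P : probability T R) (I : finType)
    (gam : set E -> \bar R) (X : I -> T -> E) : Prop :=
  (forall i, measurable_fun setT (X i)) /\
  forall B : I -> set E, (forall i, measurable (B i)) ->
    P (\bigcap_(i in [set: I]) (X i @^-1` B i)) = (\prod_i gam (B i))%E.

(** Generators of the product sigma-algebra on [I -> E]. They are stable under intersection, so the
    law of a family is determined by its values on them. *)
Definition boxes (I : finType) d (E : measurableType d) : set (set (I -> E)) :=
  [set A | exists B : I -> set E, (forall i, measurable (B i)) /\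
     A = [set w | forall i, B i (w i)]].

Local Notation family_space I E := (g_sigma_algebraType (@boxes I _ E)).

Lemma bigcap_fin_measurable d (T : measurableType d) (I : finType)
    (F : I -> set T) : (forall i, measurable (F i)) ->
  measurable (\bigcap_(i in [set: I]) F i).
Proof.
move=> mF.
by apply: fin_bigcap_measurable => //; exact: finite_finset.
Qed.

Section family_space.
Context d (E : measurableType d) (I : finType).

Lemma measurable_coord (i : I) :
  measurable_fun setT (fun w : family_space I E => w i).
Proof.
move=> _ B mB; rewrite setTI; apply: sub_sigma_algebra.
exists (fun j => if j == i then B else setT); split.
  by move=> j; case: ifP.
apply/seteqP; split => [w/= Bw j|w /= /(_ i)]; last by rewrite eqxx.
by case: ifP => [/eqP->|].
Qed.

Lemma measurable_family d' (T : measurableType d') (X : I -> T -> E) :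
  (forall i, measurable_fun setT (X i)) ->
  measurable_fun setT ((fun t i => X i t) : T -> family_space I E).
Proof.
move=> mX.
apply: (@measurability d' _ T (family_space I E) setT _ (@boxes I _ E)) => //.
move=> _ [_ [B [mB ->]] <-].
rewrite setTI (_ : _ @^-1` _ = \bigcap_(i in [set: I]) (X i @^-1` B i)).
  by apply: bigcap_fin_measurable => i; rewrite -[_ @^-1` _]setTI; exact: mX.
by apply/seteqP; split => [t /= h i _ | t /= h i]; apply: h.
Qed.

End family_space.

Section law_eq.
Context d1 d2 d' (T1 : measurableType d1) (T2 : measurableType d2)
  (E : measurableType d') (R : realType).
Variables (P1 : probability T1 R) (P2 : probability T2 R) (I : finType).
Variables (gam : set E -> \bar R) (X1 : I -> T1 -> E) (X2 : I -> T2 -> E).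
Hypotheses (h1 : iid P1 gam X1) (h2 : iid P2 gam X2).

(** Uniqueness of a probability given on a pi-system. It allows a family to be replaced by one with
    the same law on another space, as [decouple] does with [mix]. *)
Lemma iid_law_eq (A : set (family_space I E)) : measurable A ->
  P1 [set t | A (X1^~ t)] = P2 [set t | A (X2^~ t)].
Proof.
move=> mA.
have m1 := measurable_family h1.1; have m2 := measurable_family h2.1.
pose f1 : {mfun T1 >-> family_space I E} := mfun_Sub (mem_set m1).
pose f2 : {mfun T2 >-> family_space I E} := mfun_Sub (mem_set m2).
have := @measure_unique _ R (family_space I E) (@boxes I _ E) (fun=> setT) erefl _ _ _
  (pushforward P1 f1) (pushforward P2 f2) _ _ A mA.
rewrite /pushforward/=; apply.
- move=> _ _ [B [mB ->]] [C [mC ->]]; exists (fun i => B i `&` C i); split.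
    by move=> i; exact: measurableI.
  apply/seteqP; split => [w [/= hB hC] i|w /= h]; first by split.
  by split => i; have [] := h i.
- by move=> _; exists (fun=> setT); split => //; apply/seteqP.
- by rewrite bigcup_const //; exists 0%N.
- exact: m1.
- exact: m2.
- move=> _ [B [mB ->]].
  have := h1.2 B mB; rewrite -(h2.2 B mB).
  rewrite (_ : \bigcap_(i in _) _ = [set t | forall i, B i (X1 i t)]); last first.
    by apply/seteqP; split => [t /= h i | t /= h i _]; apply: h.
  rewrite (_ : \bigcap_(i in _) _ = [set t | forall i, B i (X2 i t)]); last first.
    by apply/seteqP; split => [t /= h i | t /= h i _]; apply: h.
  by [].
- by move=> _; rewrite /pushforward preimage_setT probability_setT ltry.
Qed.

End law_eq.

Section decouple.
Context d d' (T : measurableType d) (E : measurableType d') (R : realType).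
Variables (P : probability T R) (I : finType) (gam : set E -> \bar R).
Variables (X : I -> T -> E).
Hypothesis iidX : iid P gam X.
Hypothesis gamT : gam setT = 1%E.
Variable A : {set I}.

(* Keeps the coordinates in [A] and resamples the others independently, so that
   conditioning on [A] becomes an integral over the product space. *)
Definition mix (t s : T) (i : I) : E := if i \in A then X i t else X i s.

(** A box for the mixed family is a rectangle in [T * T]: each coordinate is constrained in one
    factor and free in the other, where it contributes [gam setT = 1]. *)
Lemma iid_mix : iid (P \x P)%E gam (fun i (ts : T * T) => mix ts.1 ts.2 i).
Proof.
have [mX boxX] := iidX.
split=> [i|B mB].
  rewrite /mix; case: (i \in A).
    exact: (measurableT_comp (mX i) measurable_fst).
  exact: (measurableT_comp (mX i) measurable_snd).
pose B1 i := if i \in A then B i else setT.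
pose B2 i := if i \in A then setT else B i.
have mB1 i : measurable (B1 i) by rewrite /B1; case: ifP.
have mB2 i : measurable (B2 i) by rewrite /B2; case: ifP.
rewrite (_ : \bigcap_(i in _) _ = (\bigcap_(i in [set: I]) (X i @^-1` B1 i)) `*`
  (\bigcap_(i in [set: I]) (X i @^-1` B2 i))); last first.
  apply/seteqP; split => [[t s] /= h|[t s] /= [h1 h2] i _].
    split => i _ /=; have /= := h i Logic.I; rewrite /mix /B1 /B2;
      by case: ifP.
  have /= := h1 i Logic.I; have /= := h2 i Logic.I; rewrite /mix /B1 /B2.
  by case: ifP.
have mcap B' : (forall i, measurable (B' i)) ->
    measurable (\bigcap_(i in [set: I]) (X i @^-1` B' i)).
  by move=> mB'; apply: bigcap_fin_measurable => i;
    rewrite -[_ @^-1` _]setTI; exact: mX.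
rewrite [LHS]product_measure1E; [|exact: mcap..].
rewrite -[LHS]/(P (\bigcap_(i in [set: I]) (X i @^-1` B1 i)) *
  P (\bigcap_(i in [set: I]) (X i @^-1` B2 i)))%E.
rewrite !boxX// -big_split/=; apply: eq_bigr => i _.
by rewrite /B1 /B2; case: ifP => _; rewrite gamT ?mule1 ?mul1e.
Qed.

Variable C : set (family_space I E).
Hypothesis mC : measurable C.

Let mD : measurable [set ts : T * T | C (mix ts.1 ts.2)].
Proof.
have := measurable_family (iid_mix).1; move=> /(_ measurableT _ mC).
by rewrite setTI.
Qed.

Lemma measurable_decouple :
  measurable_fun setT (fun t => P [set s | C (mix t s)]).
Proof.
have := @measurable_fun_xsection _ _ T T R P _ mD.
congr measurable_fun; apply/funext => t /=; congr (P _).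
by apply/seteqP; split => s /=; rewrite /xsection/= inE.
Qed.

Lemma decouple :
  P [set t | C (X^~ t)] = (\int[P]_t P [set s | C (mix t s)])%E.
Proof.
rewrite (iid_law_eq iidX iid_mix mC) /=.
apply: eq_integral => t _ /=; congr (P _).
by apply/seteqP; split => s /=; rewrite /xsection/= inE.
Qed.

Lemma decouple_le (h : T -> \bar R) : measurable_fun setT h ->
  (forall t, P [set s | C (mix t s)] <= h t)%E ->
  (P [set t | C (X^~ t)] <= \int[P]_t h t)%E.
Proof.
move=> mh le_h; rewrite decouple; apply: ge0_le_integral => //.
exact: measurable_decouple.
Qed.

Lemma decouple_ge (h : T -> \bar R) : measurable_fun setT h ->
  (forall t, 0 <= h t)%E ->
  (forall t, h t <= P [set s | C (mix t s)])%E ->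
  (\int[P]_t h t <= P [set t | C (X^~ t)])%E.
Proof.
move=> mh h0 le_h; rewrite decouple; apply: ge0_le_integral => //.
exact: measurable_decouple.
Qed.

End decouple.

(** * Densities, translations and polar coordinates for Lebesgue measure *)

Section density.
Context d (T : measurableType d) (R : realType).
Variables (mu nu : {measure set T -> \bar R}) (g : T -> R).
Hypotheses (mg : measurable_fun setT g) (g0 : forall x, 0 <= g x).
Hypothesis nuE : forall B, measurable B ->
  nu B = (\int[mu]_(x in B) (g x)%:E)%E.
Local Open Scope ereal_scope.

Import HBNNSimple.

Let density_nnsfun (f : {nnsfun T >-> R}) :
  \int[nu]_x (f x)%:E = \int[mu]_x ((f x)%:E * (g x)%:E).
Proof.
under [LHS]eq_integral do rewrite fimfunE -fsumEFin//.
rewrite [LHS]ge0_integral_fsum//; last 2 first.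
  - by move=> r; exact/measurable_EFinP/measurableT_comp.
  - by move=> n x _; rewrite EFinM nnfun_muleindic_ge0.
under [RHS]eq_integral.
  move=> x xD; rewrite fimfunE -fsumEFin// muleC ge0_mule_fsumr; last first.
    by move=> r; rewrite EFinM nnfun_muleindic_ge0.
  over.
rewrite [RHS]ge0_integral_fsum//; last 2 first.
  - move=> r; apply: emeasurable_funM; first exact/measurable_EFinP.
    by apply/measurable_EFinP; do 2 apply/measurableT_comp => //.
  - move=> n x _; apply: mule_ge0; rewrite ?lee_fin//.
    by rewrite -lee_fin EFinM nnfun_muleindic_ge0.
apply: eq_fsbigr => r _.
have mA : measurable (f @^-1` [set r]) by exact: measurable_funPTI.
have [r0|r0] := leP 0%R r; last first.
  rewrite preimage_nnfun0//.
  rewrite [LHS]integral0_eq; last by move=> x _; rewrite indic0 mulr0.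
  by rewrite [RHS]integral0_eq// => x _; rewrite indic0 mulr0 mule0.
under eq_integral do rewrite EFinM.
rewrite ge0_integralZl//; last exact/measurable_EFinP/measurable_indic.
rewrite integral_indic// setIT nuE//.
under [RHS]eq_integral do rewrite EFinM muleCA.
rewrite ge0_integralZl//; last 2 first.
- by apply: emeasurable_funM; apply/measurable_EFinP.
- by move=> x _; rewrite mule_ge0// lee_fin.
congr (_ * _); rewrite integral_mkcond; apply: eq_integral => x _.
by rewrite /= patchE indicE; case: ifP; rewrite ?mule1 ?mule0.
Qed.

Lemma ge0_integral_density (f : T -> \bar R) : measurable_fun setT f ->
  (forall x, 0 <= f x) -> \int[nu]_x f x = \int[mu]_x (f x * (g x)%:E).
Proof.
move=> mf f0.
pose f_ := nnsfun_approx measurableT mf.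
transitivity (lim (\int[nu]_x (f_ n x)%:E @[n --> \oo])).
  rewrite -monotone_convergence//=.
  - apply: eq_integral => ? /[!inE] xD; apply/esym/cvg_lim => //=.
    exact: cvg_nnsfun_approx.
  - by move=> n; exact/measurable_EFinP/measurable_funTS.
  - by move=> n ? _; rewrite lee_fin.
  - by move=> ? _ ? ? mn; rewrite lee_fin; exact/lefP/nd_nnsfun_approx.
transitivity (lim (\int[mu]_x ((f_ n x)%:E * (g x)%:E) @[n --> \oo])).
  by apply: congr_lim; apply/funext => n /=; exact: density_nnsfun.
rewrite -monotone_convergence//=.
- apply: eq_integral => x _.
  rewrite (_ : (fun n => _) = (fun n => (g x)%:E * (f_ n x)%:E)); last first.
    by apply/funext => n; rewrite muleC.
  rewrite limeMl//; first by rewrite muleC; congr (_ * _); apply/cvg_lim => //;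
     exact: cvg_nnsfun_approx.
  by apply/cvg_ex; exists (f x); exact: cvg_nnsfun_approx.
- move=> n; apply: emeasurable_funM; last exact/measurable_EFinP.
  exact/measurable_EFinP/measurable_funTS.
- by move=> n x _; rewrite mule_ge0// lee_fin.
- move=> x _ a b ab; apply: lee_wpmul2r; first by rewrite lee_fin.
  by rewrite lee_fin; exact/lefP/nd_nnsfun_approx.
Qed.

End density.

Section translation.
Context (R : realType).
Local Notation mu := (@lebesgue_measure R).
Local Open Scope ereal_scope.

Lemma lebesgue_measure_translation (a : R) (A : set R) : measurable A ->
  mu ((fun x => x + a)%R @^-1` A) = mu A.
Proof.
move=> mA.
have mf : @measurable_fun _ _ (measurableTypeR R) (measurableTypeR R) setT
    (fun x => (x + a)%R).
  exact: measurable_funD.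
pose f : {mfun measurableTypeR R >-> measurableTypeR R} :=
  @mfun_Sub _ _ (measurableTypeR R) (measurableTypeR R) _ (mem_set mf).
rewrite -[LHS]/(pushforward mu f A).
apply/esym/lebesgue_measure_unique => // _ [[x y] _ <-].
rewrite -[RHS]/(mu ((fun z => z + a)%R @^-1` `]x, y])).
rewrite (_ : _ @^-1` _ = `](x - a)%R, (y - a)%R]%classic); last first.
  by apply/seteqP; split => z /=; rewrite !in_itv/= ltrBlDr lerBrDr.
by rewrite !lebesgue_measure_itv/= !lte_fin; congr (if _ then _ else _);
  [rewrite ltrD2r|rewrite -!EFinB; congr EFin; lra].
Qed.

Lemma ge0_integral_translation (a : R) (f : R -> \bar R) :
  measurable_fun setT f -> (forall x, 0 <= f x) ->
  \int[mu]_x f (x + a)%R = \int[mu]_x f x.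
Proof.
move=> mf f0.
have mt : measurable_fun setT (fun x : measurableTypeR R => (x + a)%R : measurableTypeR R).
  exact: measurable_funD.
have := @ge0_integral_pushforward _ _ _ _ R _ mt mu setT f measurableT mf.
rewrite preimage_setT => <-; last by move=> x _.
by apply: eq_measure_integral => A mA _; first [exact: lebesgue_measure_translation|
  exact/esym/lebesgue_measure_translation].
Qed.

End translation.

Section disc.
Context (R : realType).
Local Notation mu := (@lebesgue_measure R).

Lemma derivable_continuous (F : R -> R) :
  (forall x : R, derivable F x 1) -> continuous F.
Proof.
by move=> dF x; exact/differentiable_continuous/derivable1_diffP/dF.
Qed.

Lemma derivable_LRcontinuous (F : R -> R) a b :
  (forall x : R, derivable F x 1) -> derivable_oo_LRcontinuous F a b.
Proof.
move=> dF; have cF := derivable_continuous dF.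
split; [by move=> x _; exact: dF| |].
- by apply: cvg_at_right_filter; exact: cF.
- by apply: cvg_at_left_filter; exact: cF.
Qed.

Lemma integral_cos2 (r : R) :
  (\int[mu]_(x in `[(- (pi / 2))%R, (pi / 2)%R]) (2 * r * cos x ^+ 2)%:E = (pi * r)%:E)%E.
Proof.
pose F (x : R) := r * (x + sin x * cos x).
have dF (x : R) : is_derive x 1 F (2 * r * cos x ^+ 2).
  rewrite /F; apply: is_derive_eq.
  rewrite /GRing.scale/= -[X in r * (X + _)](cos2Dsin2 x); ring.
rewrite (@continuous_FTC2 _ _ F).
- rewrite /F sinN cosN sin_pihalf cos_pihalf -EFinB; congr EFin; lra.
- by have := pi_gt0 R; lra.
- by apply: continuous_subspaceT; apply: derivable_continuous.
- exact: derivable_LRcontinuous.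
- by move=> x _; rewrite derive1E derive_val.
Qed.

(** The substitution [x = sqrt r * sin t] turns the integrand into [2 * r * cos t ^+ 2]. *)
Lemma integral_half_disc (r : R) : 0 < r ->
  (\int[mu]_(x in `[(- Num.sqrt r)%R, Num.sqrt r]) (2 * Num.sqrt (r - x ^+ 2))%:E
   = (pi * r)%:E)%E.
Proof.
move=> r0; have s0 : 0 < Num.sqrt r by rewrite sqrtr_gt0.
pose F (x : R) := Num.sqrt r * sin x.
have dF (x : R) : is_derive x 1 F (Num.sqrt r * cos x) by exact: is_deriveZ.
have F'E : F^`()%classic = (fun x => Num.sqrt r * cos x).
  by apply/funext => x; rewrite derive1E derive_val.
have cF' : continuous (fun x : R => Num.sqrt r * cos x).
  by apply: derivable_continuous.
rewrite -integral_cos2.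
rewrite (_ : - Num.sqrt r = F (- (pi / 2))); last by rewrite /F sinN sin_pihalf mulrN1.
rewrite [X in `[_, X]](_ : _ = F (pi / 2)); last by rewrite /F sin_pihalf mulr1.
rewrite (@integration_by_substitution_increasing _ F).
- apply: eq_integral => x /[!inE]/= xpi.
  rewrite !fctE F'E /F; congr EFin.
  rewrite exprMn sqr_sqrtr; last exact: ltW.
  rewrite (_ : r - r * sin x ^+ 2 = r * cos x ^+ 2); last first.
    by rewrite -[X in X - _]mulr1 -(cos2Dsin2 x); ring.
  rewrite sqrtrM; last exact: ltW.
  rewrite sqrtr_sqr ger0_norm; last first.
    by apply: cos_ge0_pihalf; move: xpi; rewrite in_itv.
  rewrite -[in RHS](sqr_sqrtr (ltW r0)); ring.
- by have := pi_gt0 R; lra.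
- by move=> x y xp yp xy; rewrite /F ltr_pM2l// ltr_sin.
- by move=> x _; rewrite F'E; exact: cF'.
- rewrite F'E; apply/cvg_ex; eexists; apply: cvg_at_right_filter; exact: cF'.
- rewrite F'E; apply/cvg_ex; eexists; apply: cvg_at_left_filter; exact: cF'.
- exact: derivable_LRcontinuous.
- apply: continuous_subspaceT => x.
  have c1 : continuous (fun x : R => r - x ^+ 2) by apply: derivable_continuous.
  have c2 : continuous (fun x : R => 2 * x) by apply: derivable_continuous.
  have := @continuous_comp _ _ _ _ _ x (c1 x) (@sqrt_continuous R _).
  by move=> /continuous_comp /(_ (c2 _)).
Qed.

Lemma measurable_sqr_add : measurable_fun setT (fun p : R * R => p.1 ^+ 2 + p.2 ^+ 2).
Proof.
by apply: measurable_funD; apply: measurable_funX;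
  [exact: measurable_fst|exact: measurable_snd].
Qed.

Lemma disc_area (r : R) : 0 < r ->
  (mu \x mu)%E [set p : R * R | p.1 ^+ 2 + p.2 ^+ 2 <= r] = (pi * r)%:E.
Proof.
move=> r0; rewrite /product_measure1/=.
transitivity (\int[mu]_x (2 * Num.sqrt (r - x ^+ 2))%:E)%E.
  apply: eq_integral => x _ /=.
  rewrite (_ : xsection _ _ = if x ^+ 2 <= r then
     `[- Num.sqrt (r - x ^+ 2), Num.sqrt (r - x ^+ 2)]%classic else set0); last first.
    apply/seteqP; split => y; rewrite /xsection/= inE/=.
      move=> xy; have xr : x ^+ 2 <= r by have := sqr_ge0 y; lra.
      rewrite xr /= in_itv/= -ler_norml -sqrtr_sqr ler_wsqrtr//; lra.
    case: ifP => // xr; rewrite /= in_itv/= -ler_norml -sqrtr_sqr.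
    rewrite ler_psqrt ?nnegrE ?sqr_ge0 ?subr_ge0// => ?; lra.
  case: leP => xr.
    rewrite lebesgue_measure_itv/= lte_fin -EFinB.
    have [|] := ltP; last by move=> h; congr EFin; have := sqrtr_ge0 (r - x ^+ 2); lra.
    by move=> _; congr EFin; lra.
  rewrite measure0 ler0_sqrtr ?mulr0//; lra.
rewrite -integral_half_disc// [RHS]integral_mkcond; apply: eq_integral => x _.
rewrite /= patchE; case: ifPn => // /negP; rewrite inE/= in_itv/= -ler_norml => /negP.
rewrite -ltNge => xr; rewrite ler0_sqrtr ?mulr0//.
have := ltr_pM2l; rewrite subr_le0 -real_normK ?num_real// -[leLHS]sqr_sqrtr; last exact: ltW.
by rewrite ler_pXn2r ?nnegrE// ltW.
Qed.

End disc.

Local Notation RR R := (measurableTypeR R * measurableTypeR R)%type.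

Section polar.
Context (R : realType).
Local Notation mu := (@lebesgue_measure R).
Local Notation mu2 := ((@lebesgue_measure R) \x (@lebesgue_measure R))%E.

Definition sqn (p : (RR R)) : R := p.1 ^+ 2 + p.2 ^+ 2.

Lemma sqn_ge0 p : 0 <= sqn p.
Proof. by rewrite addr_ge0 ?sqr_ge0. Qed.

Lemma measurable_sqn : @measurable_fun _ _ _ (measurableTypeR R) setT sqn.
Proof. exact: measurable_sqr_add. Qed.

Let D (r : R) : set (RR R) := sqn @^-1` `]-oo, r].

Let mD r : measurable (D r).
Proof. by rewrite -[D r]setTI; apply: measurable_sqn. Qed.

Let DE r : D r = [set p : (RR R) | p.1 ^+ 2 + p.2 ^+ 2 <= r].
Proof. by apply/seteqP; split=> p; rewrite /D/= in_itv. Qed.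

Let area r : 0 <= r -> mu2 (D r) = (pi * r)%:E.
Proof.
rewrite le_eqVlt => /predU1P[<-|r0]; last by rewrite DE; exact: disc_area.
rewrite mulr0; apply/eqP; rewrite eq_le measure_ge0 andbT.
apply/lee_addgt0Pr => e e0; rewrite add0e.
(* For [r = 0] the set is squeezed inside the disc of squared radius [e / pi], whose area is [e]. *)
have e1 : 0 < e / pi by rewrite divr_gt0 ?pi_gt0.
have -> : e = pi * (e / pi) by rewrite mulrC divfK// gt_eqF// pi_gt0.
rewrite -disc_area// -DE.
apply: le_measure; rewrite ?inE//; try exact: mD.
by move=> p; rewrite /D/= !in_itv/= => /le_trans; apply; exact: ltW.
Qed.

Let push : {measure set (measurableTypeR R) -> \bar R} :=
  measure_function_pushforward__canonical__measure_function_Measure mu2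
    measurable_sqn.

Let Nneg : set (measurableTypeR R) := `]-oo, 0%R[%classic.
Let mNneg : measurable Nneg. Proof. exact: measurable_itv. Qed.

Let pinv : {nonneg R} := (NngNum (ltW (@pi_gt0 R)))%:num^-1%:nng.

(* [pi^-1] times the law of [sqn] is carried by the nonnegative reals; completed
   by Lebesgue measure on the negative ones it agrees with [mu] on intervals. *)
Let m' := measure_add (mscale pinv push) (mrestr mu mNneg).

Let m'E X : m' X = ((pi^-1)%:E * mu2 (sqn @^-1` X) + mu (X `&` `]-oo, 0%R[))%E.
Proof. by rewrite /m' measure_addE. Qed.

Let m'_lebesgue (X : set R) : measurable X -> mu X = m' X.
Proof.
move=> mX; apply: lebesgue_measure_unique => // _ [[a b] _ <-].
rewrite -[RHS]/(m' `]a, b]) m'E /=; have [ab|ba] := ltP a b; last first.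
  rewrite set_itv_ge ?bnd_simp -?leNgt//.
  by rewrite preimage_set0 set0I !measure0 mule0 adde0.
have pi0 := @pi_gt0 R.
rewrite lebesgue_measure_itv/= lte_fin ab.
have [a0|a0] := ltP a 0; last first.
  rewrite (_ : `]a, b]%classic `&` _ = set0); last first.
    by apply/seteqP; split => z //=; rewrite !in_itv/= => -[]; lra.
  rewrite measure0 adde0 (_ : _ @^-1` _ = D b `\` D a); last first.
    apply/seteqP; split => p; rewrite /D/= !in_itv/=; last first.
      by move=> [-> /negP]; rewrite -ltNge => ->.
    by case/andP => h ->; split => //; apply/negP; rewrite -ltNge.
  have -> : mu2 (D b `\` D a) = (pi * b - pi * a)%:E.
    have b0 : 0 <= b by lra.
    rewrite [LHS]measureD; [|exact: mD|exact: mD|].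
      rewrite (_ : D b `&` D a = D a).
        by rewrite EFinB -(area b0) -(area a0).
      by apply/setIidPr => p; rewrite /D/= !in_itv/=; lra.
    by rewrite -[X in (X < _)%E]/(mu2 (D b)) area// ltry.
  rewrite -!EFinB -EFinM; congr EFin; field; lra.
have [b0|b0] := ltP b 0.
  rewrite (_ : _ @^-1` _ = set0); last first.
    by apply/seteqP; split => p //=; rewrite in_itv/=; have := sqn_ge0 p; lra.
  rewrite measure0 mule0 add0e (_ : _ `&` _ = `]a, b]%classic); last first.
    by apply/setIidPl => z /=; rewrite !in_itv/=; lra.
  by rewrite lebesgue_measure_itv/= lte_fin ab.
rewrite (_ : _ @^-1` _ = D b); last first.
  by apply/seteqP; split => p; rewrite /D/= !in_itv/=; have := sqn_ge0 p; lra.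
rewrite area// (_ : _ `&` _ = `]a, 0[%classic); last first.
  by apply/seteqP; split => z /=; rewrite !in_itv/=; [case; lra|move=> ?; split; lra].
rewrite lebesgue_measure_itv/= lte_fin a0 -!EFinB -EFinM -EFinD; congr EFin.
by field; lra.
Qed.

Lemma mu2_sqn_preimage (B : set R) : measurable B ->
  mu2 (sqn @^-1` B) = (pi%:E * mu (B `&` `[0%R, +oo[))%E.
Proof.
move=> mB; have pi0 := @pi_gt0 R.
rewrite m'_lebesgue; last exact: measurableI.
rewrite m'E -setIA (_ : `[0%R, +oo[%classic `&` _ = set0); last first.
  by apply/seteqP; split => z //=; rewrite !in_itv/=; case; lra.
rewrite setI0 measure0 adde0 muleA -EFinM divff ?gt_eqF// mul1e.
congr (mu2 _); apply/seteqP; split => p //=; last by case.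
by split => //; rewrite in_itv/= sqn_ge0.
Qed.

(** In the variable [u = rho^2] the polar element [rho drho dtheta] is [du dtheta / 2]; the angle
    integrates to [2 pi], which leaves the factor [pi]. *)
Lemma ge0_integral_polar (f : R -> \bar R) : measurable_fun setT f ->
  (forall u, 0 <= f u)%E ->
  (\int[mu2]_p f (sqn p) = pi%:E * \int[mu]_(u in `[0%R, +oo[) f u)%E.
Proof.
move=> mf f0; have pi0 := @pi_gt0 R.
have := @ge0_integral_pushforward _ _ _ _ R _ measurable_sqn mu2 setT f measurableT mf.
rewrite preimage_setT => <-; last by move=> x _.
pose g (u : measurableTypeR R) : R := pi * \1_(`[0%R, +oo[%classic : set R) u.
rewrite (@ge0_integral_density _ _ R mu push g) => //.
- rewrite [X in (_ * X)%E]integral_mkcond -ge0_integralZl//.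
  + apply: eq_integral => u _; rewrite patchE /g indicE.
    by case: ifP => _; rewrite ?mulr1 ?mulr0 ?mule0// muleC.
  + by apply: (iffLR (measurable_restrictT f (measurable_itv _))); exact: measurable_funTS.
  + by move=> u _; rewrite patchE; case: ifP.
  + by rewrite lee_fin ltW.
- by apply: measurable_funM => //; exact: measurable_indic.
- by move=> u; rewrite /g; apply: mulr_ge0; [exact: ltW|rewrite indicE; case: (_ \in _)].
- move=> B mB; rewrite -[LHS]/(mu2 (sqn @^-1` B)) mu2_sqn_preimage//.
  under eq_integral do rewrite /g EFinM.
  rewrite ge0_integralZl//; first by rewrite integral_indic// setIC.
  exact/measurable_EFinP/measurable_funTS/measurable_indic.
by rewrite lee_fin ltW.
Qed.

End polar.

(** * Squared moduli and measurability of complex-valued functions *)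

Section complex_measurability.
Context (R : realType).

Definition toC (p : RR R) : R[i] := Complex p.1 p.2.

Lemma re_imK : cancel (@re_im R) toC. Proof. by case. Qed.
Lemma toCK : cancel toC (@re_im R). Proof. by case. Qed.

(** The squared modulus as an element of [R]; the norm on [R[i]] takes its values in [R[i]]. *)
Definition nsq (z : R[i]) : R := sqn (re_im z).

Lemma nsqE z : nsq z = complex.Re z ^+ 2 + complex.Im z ^+ 2. Proof. by []. Qed.

Lemma nsq_ge0 z : 0 <= nsq z. Proof. exact: sqn_ge0. Qed.

Lemma nsqM (z w : R[i]) : nsq (z * w) = nsq z * nsq w.
Proof. by case: z w => [a b] [c d]; rewrite !nsqE /=; ring. Qed.

Lemma nsq_eq0 z : (nsq z == 0) = (z == 0).
Proof.
case: z => a b; rewrite nsqE/= paddr_eq0 ?sqr_ge0// !sqrf_eq0.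
by rewrite eq_complex/=.
Qed.

Lemma nsq0 : nsq 0 = 0.
Proof. by apply/eqP; rewrite nsq_eq0. Qed.

Lemma nsq1 : nsq 1 = 1.
Proof. by rewrite nsqE /= expr1n expr0n addr0. Qed.

Lemma nsqV z : nsq z^-1 = (nsq z)^-1.
Proof.
have [->|z0] := eqVneq z 0; first by rewrite invr0 nsq0 invr0.
apply: (@mulfI _ (nsq z)); first by rewrite nsq_eq0.
by rewrite -nsqM !divff ?nsq1// nsq_eq0.
Qed.

Lemma nsq_real (z : R[i]) : z * z^*%C = (nsq z)%:C%C.
Proof.
case: z => a b; rewrite nsqE/=; apply/eqP; rewrite eq_complex/=.
by apply/andP; split; apply/eqP; ring.
Qed.

Definition cmeasurable d (T : measurableType d) (f : T -> R[i]) :=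
  @measurable_fun _ _ T (RR R) setT (fun t => re_im (f t)).

Section cmeas.
Context d (T : measurableType d).
Implicit Types f g : T -> R[i].

Lemma cmeasurableP f : cmeasurable f <->
  @measurable_fun _ _ T (measurableTypeR R) setT (fun t => complex.Re (f t)) /\
  @measurable_fun _ _ T (measurableTypeR R) setT (fun t => complex.Im (f t)).
Proof.
split=> [mf|[m1 m2]]; last exact: measurable_fun_pair.
split; first exact: (measurableT_comp measurable_fst mf).
exact: (measurableT_comp measurable_snd mf).
Qed.

Lemma cmeasurable_cst (z : R[i]) : cmeasurable (fun _ : T => z).
Proof. exact: measurable_cst. Qed.

Lemma cmeasurableD f g : cmeasurable f -> cmeasurable g ->
  cmeasurable (fun t => f t + g t).
Proof.
move=> /cmeasurableP[f1 f2] /cmeasurableP[g1 g2]; apply/cmeasurableP.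
by rewrite (_ : (fun t => complex.Re _) = (fun t => complex.Re (f t) + complex.Re (g t)));
  [rewrite (_ : (fun t => complex.Im _) = (fun t => complex.Im (f t) + complex.Im (g t)));
  [split; exact: measurable_funD|]|];
  apply/funext => t; case: (f t) (g t) => [? ?] [].
Qed.

Lemma cmeasurableM f g : cmeasurable f -> cmeasurable g ->
  cmeasurable (fun t => f t * g t).
Proof.
move=> /cmeasurableP[f1 f2] /cmeasurableP[g1 g2]; apply/cmeasurableP.
rewrite (_ : (fun t => complex.Re _) = (fun t => complex.Re (f t) * complex.Re (g t)
  - complex.Im (f t) * complex.Im (g t))); last first.
  by apply/funext => t; case: (f t) (g t) => [? ?] [].
rewrite (_ : (fun t => complex.Im _) = (fun t => complex.Re (f t) * complex.Im (g t)
  + complex.Im (f t) * complex.Re (g t))); last first.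
  by apply/funext => t; case: (f t) (g t) => [? ?] [].
split; first by apply: measurable_funB; exact: measurable_funM.
by apply: measurable_funD; exact: measurable_funM.
Qed.

Lemma cmeasurable_sum (I : Type) (s : seq I) (h : I -> T -> R[i]) :
  (forall i, cmeasurable (h i)) -> cmeasurable (fun t => \sum_(i <- s) h i t).
Proof.
move=> mh; elim: s => [|i s IH].
  by under eq_fun do rewrite big_nil; exact: cmeasurable_cst.
by under eq_fun do rewrite big_cons; exact: cmeasurableD.
Qed.

Lemma measurable_nsq f : cmeasurable f ->
  @measurable_fun _ _ T (measurableTypeR R) setT (fun t => nsq (f t)).
Proof. by move=> mf; apply: (measurableT_comp (@measurable_sqn R) mf). Qed.

End cmeas.

Lemma cmeasurable_comp d1 d2 (T1 : measurableType d1) (T2 : measurableType d2)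
    (f : T2 -> R[i]) (h : T1 -> T2) :
  measurable_fun setT h -> cmeasurable f -> cmeasurable (fun t => f (h t)).
Proof. by move=> mh mf; exact: (measurableT_comp mf mh). Qed.

Lemma cmeasurable_toC : cmeasurable toC.
Proof.
rewrite /cmeasurable (_ : (fun t => _) = id); first exact: measurable_id.
by apply/funext => t; rewrite toCK.
Qed.

End complex_measurability.

(** * Product densities, shears and Givens rotations *)

Section product_density.
Context d1 d2 (T1 : measurableType d1) (T2 : measurableType d2) (R : realType).
Variables (m1 n1 : {sigma_finite_measure set T1 -> \bar R}).
Variables (m2 n2 : {sigma_finite_measure set T2 -> \bar R}).
Variables (g1 : T1 -> R) (g2 : T2 -> R).
Hypotheses (mg1 : measurable_fun setT g1) (g10 : forall x, 0 <= g1 x).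
Hypotheses (mg2 : measurable_fun setT g2) (g20 : forall x, 0 <= g2 x).
Local Open Scope ereal_scope.
Hypothesis h1 : forall f : T1 -> \bar R, measurable_fun setT f ->
  (forall x, 0 <= f x) -> \int[n1]_x f x = \int[m1]_x (f x * (g1 x)%:E).
Hypothesis h2 : forall f : T2 -> \bar R, measurable_fun setT f ->
  (forall x, 0 <= f x) -> \int[n2]_x f x = \int[m2]_x (f x * (g2 x)%:E).

Lemma ge0_integral_prod_density (f : T1 * T2 -> \bar R) :
  measurable_fun setT f -> (forall x, 0 <= f x) ->
  \int[n1 \x n2]_p f p = \int[m1 \x m2]_p (f p * (g1 p.1 * g2 p.2)%:E).
Proof.
move=> mf f0.
have mfg : measurable_fun setT (fun p => f p * (g1 p.1 * g2 p.2)%:E).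
  apply: emeasurable_funM => //; apply/measurable_EFinP; apply: measurable_funM.
    exact: (measurableT_comp mg1 measurable_fst).
  exact: (measurableT_comp mg2 measurable_snd).
rewrite fubini_tonelli1// fubini_tonelli1//; last first.
  by move=> p; rewrite mule_ge0// lee_fin mulr_ge0.
rewrite h1; last 2 first.
- exact: measurable_fun_fubini_tonelli_F.
- by move=> x; apply: integral_ge0.
apply: eq_integral => x _.
have mfx : measurable_fun setT (fun y => f (x, y)).
  exact: measurableT_comp.
rewrite /fubini_F h2// muleC -ge0_integralZl//.
- by apply: eq_integral => y _; rewrite EFinM muleCA.
- by apply: emeasurable_funM => //; exact/measurable_EFinP.
- by move=> y _; rewrite mule_ge0// lee_fin.
by rewrite lee_fin.
Qed.

End product_density.

(** A named copy of planar Lebesgue measure, to which a sigma-finite structure is attached so that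
    it can itself be a factor of a product measure. *)
Definition leb2 (R : realType) : set (RR R) -> \bar R :=
  ((@lebesgue_measure R) \x (@lebesgue_measure R))%E.

HB.instance Definition _ (R : realType) := Measure.on (@leb2 R).

Lemma leb2_sigma_finite (R : realType) : sigma_finite setT (@leb2 R).
Proof.
have /sigma_finiteP[F [TF ndF Foo]] := sigma_finiteT (@lebesgue_measure R).
exists (fun n => F n `*` F n).
  rewrite -setXTT TF predeqE => -[x y]; split.
    move=> [/= [n _ Fnx] [k _ Fky]]; exists (maxn n k) => //; split.
    - by move: x Fnx; exact/subsetPset/ndF/leq_maxl.
    - by move: y Fky; exact/subsetPset/ndF/leq_maxr.
  by move=> [n _ []/= ? ?]; split; exists n.
move=> k; have [? ?] := Foo k; split; first exact: measurableX.
by rewrite /leb2 product_measure1E// lte_mul_pinfty// ge0_fin_numE.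
Qed.

HB.instance Definition _ (R : realType) :=
  Measure_isSigmaFinite.Build _ _ _ (@leb2 R) (@leb2_sigma_finite R).

Section shear.
Context (R : realType).
Local Notation mu := (@lebesgue_measure R).
Local Notation mu2 := (@leb2 R).
Local Notation mu4 := (mu2 \x mu2)%E.
Local Open Scope ereal_scope.

Lemma ge0_integral_translation2 (a : RR R) (f : RR R -> \bar R) :
  measurable_fun setT f -> (forall p, 0 <= f p) ->
  \int[mu2]_p f (p.1 + a.1, p.2 + a.2)%R = \int[mu2]_p f p.
Proof.
move=> mf f0; rewrite /leb2.
have mt : measurable_fun setT (fun p : RR R => (p.1 + a.1, p.2 + a.2)%R : RR R).
  by apply: measurable_fun_pair; apply: measurable_funD.
have mfy x : measurable_fun setT (fun y => f (x, y)) by exact: measurableT_comp.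
rewrite fubini_tonelli1//; last exact: (measurableT_comp mf mt).
rewrite (fubini_tonelli1 f mf f0).
rewrite -[RHS](ge0_integral_translation a.1); last 2 first.
- by have := @measurable_fun_fubini_tonelli_F _ _ _ _ _ mu f mf f0; exact: id.
- by move=> x; exact: integral_ge0.
apply: eq_integral => x _; rewrite /fubini_F/=.
exact: (ge0_integral_translation a.2 (mfy _)).
Qed.

Definition shear1 (a : R[i]) (pq : RR R * RR R) : RR R * RR R :=
  (re_im (toC pq.1 + a * toC pq.2)%R, pq.2).
Definition shear2 (a : R[i]) (pq : RR R * RR R) : RR R * RR R :=
  (pq.1, re_im (toC pq.2 + a * toC pq.1)%R).

Lemma cmeasurable_fst d d' (T1 : measurableType d) (T2 : measurableType d') (f : T1 -> R[i]) :
  cmeasurable f -> cmeasurable (fun x : T1 * T2 => f x.1).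
Proof. by move=> mf; apply: (cmeasurable_comp measurable_fst). Qed.
Lemma cmeasurable_snd d d' (T1 : measurableType d) (T2 : measurableType d') (f : T2 -> R[i]) :
  cmeasurable f -> cmeasurable (fun x : T1 * T2 => f x.2).
Proof. by move=> mf; apply: (cmeasurable_comp measurable_snd). Qed.

Lemma measurable_shear1 a : measurable_fun setT (shear1 a).
Proof.
apply: measurable_fun_pair; last exact: measurable_snd.
apply: cmeasurableD; first exact: (cmeasurable_fst (@cmeasurable_toC R)).
apply: cmeasurableM; first exact: cmeasurable_cst.
exact: (cmeasurable_snd (@cmeasurable_toC R)).
Qed.

Lemma measurable_shear2 a : measurable_fun setT (shear2 a).
Proof.
apply: measurable_fun_pair; first exact: measurable_fst.
apply: cmeasurableD; first exact: (cmeasurable_snd (@cmeasurable_toC R)).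
apply: cmeasurableM; first exact: cmeasurable_cst.
exact: (cmeasurable_fst (@cmeasurable_toC R)).
Qed.

Lemma re_imD (z w : R[i]) : re_im (z + w)%R =
  ((re_im z).1 + (re_im w).1, (re_im z).2 + (re_im w).2)%R.
Proof. by case: z w => [? ?] []. Qed.

(** Once the second variable is fixed, the shear is a translation of the first one. *)
Lemma ge0_integral_shear1 a (f : RR R * RR R -> \bar R) :
  measurable_fun setT f -> (forall p, 0 <= f p) ->
  \int[mu4]_p f (shear1 a p) = \int[mu4]_p f p.
Proof.
move=> mf f0.
rewrite (fubini_tonelli2 (fun p => f (shear1 a p)))//; last first.
  exact: (measurableT_comp mf (measurable_shear1 a)).
rewrite (fubini_tonelli2 f mf f0); apply: eq_integral => q _.
rewrite /fubini_G /shear1 /=.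
have mfq : measurable_fun setT (fun p => f (p, q)) by exact: measurableT_comp.
have := ge0_integral_translation2 (re_im (a * toC q)%R) mfq.
move=> <-//; apply: eq_integral => p _; congr (f (_, _)).
by rewrite re_imD toCK.
Qed.

Lemma ge0_integral_shear2 a (f : RR R * RR R -> \bar R) :
  measurable_fun setT f -> (forall p, 0 <= f p) ->
  \int[mu4]_p f (shear2 a p) = \int[mu4]_p f p.
Proof.
move=> mf f0.
rewrite (fubini_tonelli1 (fun p => f (shear2 a p)))//; last first.
  exact: (measurableT_comp mf (measurable_shear2 a)).
rewrite (fubini_tonelli1 f mf f0); apply: eq_integral => p _.
rewrite /fubini_F /shear2 /=.
have mfp : measurable_fun setT (fun q => f (p, q)) by exact: measurableT_comp.
have := ge0_integral_translation2 (re_im (a * toC p)%R) mfp.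
move=> <-//; apply: eq_integral => q _; congr (f (_, _)).
by rewrite re_imD toCK.
Qed.

Definition givens (c s : R[i]) (pq : RR R * RR R) : RR R * RR R :=
  (re_im (c * toC pq.1 + s * toC pq.2)%R,
   re_im (- s^*%C * toC pq.1 + c^*%C * toC pq.2)%R).

(* Shears preserve Lebesgue measure, hence so do Givens rotations; no
   multidimensional change of variables is needed. *)
Lemma givensE c s : (nsq c + nsq s)%R = 1%R -> s != 0%R ->
  let y := (- s^*%C)%R in
  givens c s = shear1 ((c - 1) / y)%R \o shear2 y \o shear1 ((c^*%C - 1) / y)%R.
Proof.
move=> cs1 s0 y.
have y0 : y != 0%R by rewrite oppr_eq0 fmorph_eq0.
have h : (c * c^*%C + s * s^*%C = 1)%R.
  by rewrite !nsq_real -rmorphD/= cs1.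
apply/funext => -[p q]; rewrite /givens /shear1 /shear2/= !re_imK.
set P := toC p; set Q := toC q.
have e2 : (- s^*%C * P + c^*%C * Q = Q + y * (P + (c^*%C - 1) / y * Q))%R.
  rewrite (_ : y * _ = y * P + (c^*%C - 1) * Q)%R; last by field.
  by rewrite /y; ring.
rewrite -e2; congr (re_im _, _).
(* Multiplying by [y] clears the denominators; what remains is a multiple of
   [1 - (c * c^* + s * s^* )]. *)
suff : (y * (c * P + s * Q - (P + (c^*%C - 1) / y * Q +
    (c - 1) / y * (- s^*%C * P + c^*%C * Q))) = 0)%R.
  by move=> /eqP; rewrite mulf_eq0 (negbTE y0)/= subr_eq0 => /eqP.
rewrite (_ : (_ * _ = y * c * P + y * s * Q - (y * P + (c^*%C - 1) * Q +
    (c - 1) * (- s^*%C * P + c^*%C * Q)))%R); last by field.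
transitivity ((1 - (c * c^*%C + s * s^*%C)) * Q)%R; first by rewrite /y; ring.
by rewrite h subrr mul0r.
Qed.

Lemma measurable_givens c s : measurable_fun setT (givens c s).
Proof.
by apply: measurable_fun_pair; apply: cmeasurableD; apply: cmeasurableM;
  try exact: cmeasurable_cst;
  (exact: (cmeasurable_fst (@cmeasurable_toC R)) || exact: (cmeasurable_snd (@cmeasurable_toC R))).
Qed.

Lemma sqn_givens c s pq : (nsq c + nsq s)%R = 1%R ->
  (sqn (givens c s pq).1 + sqn (givens c s pq).2 = sqn pq.1 + sqn pq.2)%R.
Proof.
case: c s pq => [c1 c2] [s1 s2] [[p1 p2] [q1 q2]]; rewrite !nsqE /sqn/= => h.
transitivity ((c1 ^+ 2 + c2 ^+ 2 + (s1 ^+ 2 + s2 ^+ 2)) *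
  (p1 ^+ 2 + p2 ^+ 2 + (q1 ^+ 2 + q2 ^+ 2)))%R; first by ring.
by rewrite h mul1r.
Qed.

Lemma ge0_integral_givens c s (f : RR R * RR R -> \bar R) :
  (nsq c + nsq s)%R = 1%R -> s != 0%R ->
  measurable_fun setT f -> (forall p, 0 <= f p) ->
  \int[mu4]_p f (givens c s p) = \int[mu4]_p f p.
Proof.
move=> cs1 s0 mf f0; rewrite givensE//=; set y := (- s^*%C)%R.
have m1 := measurableT_comp mf (measurable_shear1 ((c - 1) / y)%R).
have m2 := measurableT_comp m1 (measurable_shear2 y).
exact: (etrans (ge0_integral_shear1 _ m2 (fun=> f0 _))
  (etrans (ge0_integral_shear2 _ m1 (fun=> f0 _)) (ge0_integral_shear1 _ mf f0))).
Qed.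

End shear.

(** * The complex normal law *)

Section complex_normal_measure.
Context (R : realType).
Local Notation mu := (@lebesgue_measure R).
Local Open Scope ereal_scope.

Definition cnormal_prob (v : R) : probability (RR R) R :=
  ((normal_prob 0%R (Num.sqrt (v / 2))) \x (normal_prob 0%R (Num.sqrt (v / 2))))%E.

(** The argument [u] is the squared modulus of the point, through which alone the density depends on
    it. *)
Definition cnormal_pdf (v u : R) : R := ((pi * v)^-1 * expR (- (u / v)))%R.

Lemma measurable_cnormal_pdf v : measurable_fun setT (cnormal_pdf v).
Proof.
apply: measurable_funM => //; apply: measurableT_comp => //.
by apply: measurableT_comp => //; exact: measurable_funM.
Qed.

Lemma cnormal_pdf_ge0 v u : (0 < v)%R -> (0 <= cnormal_pdf v u)%R.
Proof.
by move=> v0; rewrite mulr_ge0 ?expR_ge0// invr_ge0 mulr_ge0 ?pi_ge0// ltW.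
Qed.

Lemma normal_pdf_prod (v x y : R) : (0 < v)%R ->
  (normal_pdf 0 (Num.sqrt (v / 2)) x * normal_pdf 0 (Num.sqrt (v / 2)) y =
  cnormal_pdf v (x ^+ 2 + y ^+ 2))%R.
Proof.
move=> v0; have s0 : Num.sqrt (v / 2) != 0%R.
  by rewrite gt_eqF// sqrtr_gt0 divr_gt0.
rewrite !normal_pdfE// /normal_peak /normal_fun sqr_sqrtr; last first.
  by rewrite divr_ge0// ltW.
have pi0 := @pi_gt0 R.
rewrite mulrACA -expRD -invfM -expr2 sqr_sqrtr; last first.
  by rewrite mulrn_wge0// mulr_ge0 ?ltW// divr_gt0.
rewrite /cnormal_pdf; congr (_^-1 * expR _)%R; first by rewrite -mulr_natr; field.
rewrite !subr0 -(mulr_natr (v / 2)); field; rewrite gt_eqF//.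
Qed.

Lemma ge0_integral_normal_prob (m s : R) (f : measurableTypeR R -> \bar R) :
  measurable_fun setT f -> (forall x, 0 <= f x) ->
  \int[normal_prob m s]_x f x = \int[mu]_x (f x * (normal_pdf m s x)%:E).
Proof.
move=> mf f0; apply: ge0_integral_density => //.
- exact: measurable_normal_pdf.
- by move=> x; exact: normal_pdf_ge0.
Qed.

Lemma ge0_integral_cnormal v (f : RR R -> \bar R) : (0 < v)%R ->
  measurable_fun setT f -> (forall x, 0 <= f x) ->
  \int[cnormal_prob v]_p f p = \int[@leb2 R]_p (f p * (cnormal_pdf v (sqn p))%:E).
Proof.
move=> v0 mf f0.
pose g := @normal_pdf R 0 (Num.sqrt (v / 2)).
have := @ge0_integral_prod_density _ _ (measurableTypeR R) (measurableTypeR R) R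
  mu (normal_prob 0 (Num.sqrt (v / 2))) mu (normal_prob 0 (Num.sqrt (v / 2)))
  g g (measurable_normal_pdf _ _) (normal_pdf_ge0 _ _)
  (measurable_normal_pdf _ _) (normal_pdf_ge0 _ _)
  (@ge0_integral_normal_prob _ _) (@ge0_integral_normal_prob _ _) f mf f0.
move=> ->; apply: eq_integral => p _; congr (_ * _%:E).
exact: normal_pdf_prod.
Qed.

(** The [pi] of the polar formula cancels the one in the density: the squared modulus of a complex
    normal variable is exponential with mean [v]. *)
Lemma cnormal_polar v (f : R -> \bar R) : (0 < v)%R ->
  measurable_fun setT f -> (forall x, 0 <= f x) ->
  \int[cnormal_prob v]_p f (sqn p) = \int[mu]_u (f u * (exponential_pdf v^-1 u)%:E).
Proof.
move=> v0 mf f0; have pi0 := @pi_gt0 R.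
have mg : measurable_fun setT (fun u => f u * (cnormal_pdf v u)%:E).
  by apply: emeasurable_funM => //; apply/measurable_EFinP; exact: measurable_cnormal_pdf.
rewrite ge0_integral_cnormal//; last exact: (measurableT_comp mf (@measurable_sqn R)).
rewrite [LHS](ge0_integral_polar mg); last first.
  by move=> u; rewrite mule_ge0// lee_fin cnormal_pdf_ge0.
rewrite -ge0_integralZl//; last 3 first.
- exact: measurable_funTS.
- by move=> u _; rewrite mule_ge0// lee_fin cnormal_pdf_ge0.
- by rewrite lee_fin ltW.
rewrite integral_mkcond; apply: eq_integral => u _.
rewrite /exponential_pdf !patchE; case: ifP => _; last by rewrite mule0.
rewrite muleCA -EFinM; congr (_ * _%:E); rewrite /cnormal_pdf mulrA invfM mulrA divff ?gt_eqF//.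
by rewrite mul1r mulNr (mulrC u).
Qed.

Lemma cnormal_sqn_gt v s : (0 < v)%R -> (0 <= s)%R ->
  cnormal_prob v [set p | s < sqn p]%R = (expR (- (s / v)))%:E.
Proof.
move=> v0 s0.
have mS : measurable [set p : RR R | (sqn p <= s)%R].
  rewrite (_ : [set p | _] = (@sqn R) @^-1` `]-oo, s]); last first.
    by apply/seteqP; split => p; rewrite /= in_itv.
  by rewrite -[X in measurable X]setTI; exact: measurable_sqn.
rewrite (_ : [set p | (s < sqn p)%R] = ~` [set p : RR R | (sqn p <= s)%R]); last first.
  by apply/seteqP; split => p /=; [move=> h; apply/negP; rewrite -ltNge
    |move=> /negP; rewrite -ltNge].
rewrite probability_setC//.
suff -> : cnormal_prob v [set p : RR R | (sqn p <= s)%R] = (1 - expR (- (s / v)))%:E.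
  by rewrite -EFinB; congr EFin; ring.
have <- : exponential_prob v^-1 `[0%R, s] = (1 - expR (- (s / v)))%:E.
  move: s0; rewrite le_eqVlt => /predU1P[<-|s0].
    by rewrite /exponential_prob set_itv1 integral_set1 mul0r oppr0 expR0 subrr.
  by rewrite exponential_prob_itv0c// mulNr mulrC EFinB.
rewrite -[X in cnormal_prob v X]setIT -integral_indic//.
rewrite (_ : (fun p => (\1_[set p : RR R | (sqn p <= s)%R] p)%:E) =
  (fun p => ((\1_(`]-oo, s]%classic : set R)) (sqn p))%:E)); last first.
  by apply/funext => p; rewrite !indicE; congr ((_ : bool)%:R%:E);
     apply/idP/idP; rewrite !inE/= in_itv.
rewrite (@cnormal_polar _ (fun u => (\1_(`]-oo, s]%classic : set R) u)%:E))//; last first.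
  exact/measurable_EFinP/measurable_indic.
rewrite /exponential_prob [RHS]integral_mkcond; apply: eq_integral => u _.
rewrite patchE indicE; have [u0|u0] := ltP u 0%R.
  rewrite lt0_exponential_pdf// mule0; case: ifP => //.
rewrite (_ : (u \in `]-oo, s]%classic) = (u \in `[0%R, s]%classic)); last first.
  by apply/idP/idP; rewrite !inE/= !in_itv/= u0.
by case: ifP; rewrite ?mul1e ?mul0e.
Qed.

(** Exponential tilting: the integrand times the density of rate [1 / v] is [(1 + a)^-1] times the
    exponential density of rate [(1 + a) / v]. *)
Lemma cnormal_laplace v a : (0 < v)%R -> (0 <= a)%R ->
  \int[cnormal_prob v]_p (expR (- (a * sqn p / v)))%:E = ((1 + a)^-1)%:E.
Proof.
move=> v0 a0.
have mE : measurable_fun setT (fun u : R => (expR (- (a * u / v)))%:E).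
  apply/measurable_EFinP/measurableT_comp => //; apply: measurableT_comp => //.
  by apply: measurable_funM => //; exact: measurable_funM.
rewrite (cnormal_polar v0 mE); last by move=> u; rewrite lee_fin expR_ge0.
have a1 : (0 < 1 + a)%R by lra.
have r0 : (0 < (1 + a) / v)%R by rewrite divr_gt0.
transitivity (((1 + a)^-1)%:E * \int[mu]_u (exponential_pdf ((1 + a) / v) u)%:E).
  2: by rewrite (integral_exponential_pdf r0) mule1.
rewrite -[RHS]ge0_integralZl; last 4 first.
- exact: measurableT.
- by apply/measurable_EFinP; exact: measurable_exponential_pdf.
- by move=> u _; rewrite lee_fin exponential_pdf_ge0// ltW.
- by rewrite lee_fin invr_ge0 ltW.
apply: eq_integral => u _; rewrite -!EFinM; congr EFin.
have [u0|u0] := ltP u 0%R; first by rewrite !lt0_exponential_pdf// !mulr0.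
rewrite !exponential_pdfE// mulrCA -expRD [RHS]mulrA; congr (_ * expR _)%R; field; lra.
Qed.

(** The joint density is a function of [sqn p.1 + sqn p.2], which a Givens rotation leaves fixed,
    and the rotation preserves Lebesgue measure. *)
Lemma cnormal_givens (c s : R[i]) v (X : set (RR R * RR R)) : (0 < v)%R ->
  (nsq c + nsq s)%R = 1%R -> s != 0%R -> measurable X ->
  (cnormal_prob v \x cnormal_prob v) (givens c s @^-1` X) =
  (cnormal_prob v \x cnormal_prob v) X.
Proof.
move=> v0 cs1 s0 mX.
have mg := @measurable_givens R c s.
have mgX : measurable (givens c s @^-1` X) by rewrite -[X in measurable X]setTI; exact: mg.
pose g (p : RR R) := cnormal_pdf v (sqn p).
have mgg : measurable_fun setT g.
  exact: (measurableT_comp (measurable_cnormal_pdf v) (@measurable_sqn R)).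
have g0 p : (0 <= g p)%R by exact: cnormal_pdf_ge0.
have E f : measurable_fun setT f -> (forall x, 0 <= f x) ->
    \int[cnormal_prob v \x cnormal_prob v]_p f p =
    \int[@leb2 R \x @leb2 R]_p (f p * (g p.1 * g p.2)%:E).
  have h f' := @ge0_integral_cnormal v f' v0.
  exact: (ge0_integral_prod_density mgg g0 mgg g0 h h).
have m1 (Y : set (RR R * RR R)) : measurable Y ->
    measurable_fun setT (fun p => (\1_Y p)%:E : \bar R).
  by move=> mY; exact/measurable_EFinP/measurable_indic.
have i0 (Y : set (RR R * RR R)) p : 0 <= (\1_Y p)%:E :> \bar R by rewrite lee_fin indicE.
rewrite -[in LHS](setIT (givens c s @^-1` X)) -[in RHS](setIT X) -!integral_indic//.
rewrite (E _ (m1 _ mgX) (i0 _)) (E _ (m1 _ mX) (i0 _)).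
pose F p := (\1_X p)%:E * (g p.1 * g p.2)%:E.
have mF : measurable_fun setT F.
  apply: emeasurable_funM; first exact: m1.
  apply/measurable_EFinP/measurable_funM.
    exact: (measurableT_comp mgg measurable_fst).
  exact: (measurableT_comp mgg measurable_snd).
have F0 p : 0 <= F p by rewrite mule_ge0// lee_fin mulr_ge0.
have <- := ge0_integral_givens cs1 s0 mF F0.
apply: eq_integral => p _; rewrite /F; congr (_ * _%:E).
rewrite /g /cnormal_pdf [LHS]mulrACA [RHS]mulrACA -!expRD; congr (_ * expR _)%R.
by rewrite -!opprD -!mulrDl sqn_givens.
Qed.

End complex_normal_measure.

(** * Integral bounds behind the small-ball estimate *)

Section ball_bound.
Context (R : realType).
Local Notation mu := (@lebesgue_measure R).

(* Bounds the probability that a Gamma variable of parameter [k], whose density is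
   at most [u^(k-1) / (k-1)!], is less than [x]. *)
Definition gamma_bound (k : nat) (x : R) : R :=
  if x <= 0 then 0 else x ^+ k / k`!%:R.

Lemma gamma_bound_ge0 k x : 0 <= gamma_bound k x.
Proof.
rewrite /gamma_bound; case: ifPn => //; rewrite -ltNge => x0.
by rewrite divr_ge0// exprn_ge0// ltW.
Qed.

Lemma measurable_gamma_bound k : measurable_fun setT (gamma_bound k).
Proof.
rewrite (_ : gamma_bound k =
  (fun x => x ^+ k / k`!%:R * (\1_(`]0, +oo[%classic : set R) x))); last first.
  apply/funext => x; rewrite /gamma_bound indicE; case: leP => x0.
    by rewrite memNset ?mulr0//= in_itv/= andbT; apply/negP; rewrite -leNgt.
  by rewrite mem_set ?mulr1//= in_itv/= x0.
apply: measurable_funM; last exact: measurable_indic.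
by apply: measurable_funM => //; exact: exprn_measurable.
Qed.

(** One convolution step: the integral of [(x - u)^k / k!] over [[0, x]] is [x^(k+1) / (k+1)!]. *)
Lemma integral_gamma_bound k x :
  (\int[mu]_(u in `[0%R, +oo[) (gamma_bound k (x - u))%:E <=
   (gamma_bound k.+1 x)%:E)%E.
Proof.
have [x0|x0] := leP x 0.
  rewrite integral0_eq ?lee_fin ?gamma_bound_ge0// => u.
  by rewrite /= in_itv/= andbT => u0; rewrite /gamma_bound ifT//; lra.
pose F (u : R) := - ((x - u) ^+ k.+1 / (k.+1)`!%:R).
have k0 : (k.+1)%:R != 0 :> R by rewrite pnatr_eq0.
have kf0 : k`!%:R != 0 :> R by rewrite pnatr_eq0 -lt0n fact_gt0.
have dF (u : R) : is_derive u 1 F ((x - u) ^+ k / k`!%:R).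
  have d1 : is_derive u 1 ((fun u : R => x - u) : R -> R) (0 - 1) by exact: is_deriveB.
  have -> : F = (- (k.+1)`!%:R^-1) \*: ((fun u : R => x - u) ^+ k.+1).
    by apply/funext => z; rewrite /= exprfctE /F mulrC -mulNr.
  apply: is_derive_eq.
  rewrite /GRing.scale/= factS natrM.
  by field; rewrite kf0 addrC natr1 k0.
have c0 : continuous (fun u : R => x - u) by apply: derivable_continuous.
have c1 : continuous (fun u : R => (x - u) ^+ k / k`!%:R).
  move=> u; apply: cvgM; last exact: cvg_cst.
  exact: (continuous_comp (c0 u) (@exprn_continuous R k _)).
have -> : (gamma_bound k.+1 x)%:E = (\int[mu]_(u in `[0%R, x]) ((x - u) ^+ k / k`!%:R)%:E)%E.
  rewrite (@continuous_FTC2 _ _ F)//.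
  - by rewrite /F subrr subr0 expr0n/= mul0r oppr0 -EFinB /gamma_bound leNgt x0/= opprK add0r.
  - exact: continuous_subspaceT.
  - exact: derivable_LRcontinuous.
  - by move=> u _; rewrite derive1E derive_val.
rewrite [leLHS]integral_mkcond [leRHS]integral_mkcond; apply: ge0_le_integral => //.
- by move=> u _; rewrite patchE; case: ifP => //; rewrite lee_fin gamma_bound_ge0.
- apply: (iffLR (measurable_restrictT _ (measurable_itv _))) => //.
  apply/measurable_funTS/measurable_EFinP.
  apply: (measurableT_comp (measurable_gamma_bound k)).
  exact: measurable_funB.
- apply: (iffLR (measurable_restrictT _ (measurable_itv _))) => //.
  apply/measurable_funTS/measurable_EFinP.
  exact: continuous_measurable_fun.
- move=> u _; rewrite !patchE.
  have -> : (u \in `[0%R, +oo[%classic) = (0 <= u).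
    by apply/idP/idP; rewrite inE/= in_itv/= andbT.
  have -> : (u \in `[0%R, x]%classic) = (0 <= u <= x).
    by apply/idP/idP; rewrite inE/= in_itv.
  case: (leP 0 u) => u0 //=; rewrite /gamma_bound.
  case: (leP u x) => ux; rewrite lee_fin; last by rewrite ifT//; lra.
  by case: ifPn => // _; rewrite divr_ge0// exprn_ge0// subr_ge0.
Qed.

(** The density is replaced by its maximum [1 / (pi v)]. What remains is a Lebesgue integral, where
    translation removes the mean [m] and polar coordinates give a factor [pi] that cancels. *)
Lemma integral_cnormal_gamma_bound k x v (m : R[i]) : 0 < v ->
  (\int[cnormal_prob v]_p (gamma_bound k (x - nsq (toC p + m)))%:E <=
   (v^-1 * gamma_bound k.+1 x)%:E)%E.
Proof.
move=> v0; have pi0 := @pi_gt0 R.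
have mh : measurable_fun setT (fun u : R => (gamma_bound k (x - u))%:E).
  apply/measurable_EFinP/(measurableT_comp (measurable_gamma_bound k)).
  exact: measurable_funB.
have mH : measurable_fun setT (fun p : RR R => (gamma_bound k (x - nsq (toC p + m)))%:E).
  apply: (measurableT_comp mh).
  apply: measurable_nsq; apply: cmeasurableD; first exact: cmeasurable_toC.
  exact: cmeasurable_cst.
rewrite ge0_integral_cnormal//; last by move=> p; rewrite lee_fin gamma_bound_ge0.
apply: (@le_trans _ _ (\int[@leb2 R]_p
    ((gamma_bound k (x - nsq (toC p + m)))%:E * ((pi * v)^-1)%:E)))%E.
  apply: ge0_le_integral => //.
  - by move=> p _; rewrite mule_ge0// lee_fin ?gamma_bound_ge0 ?cnormal_pdf_ge0.
  - apply: emeasurable_funM => //; apply/measurable_EFinP.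
    exact: (measurableT_comp (measurable_cnormal_pdf v) (@measurable_sqn R)).
  - by apply: emeasurable_funM => //; exact: measurable_cst.
  - move=> p _; rewrite lee_wpmul2l ?lee_fin ?gamma_bound_ge0// /cnormal_pdf.
    rewrite ler_piMr ?invr_ge0 ?mulr_ge0 ?(ltW v0) ?(ltW pi0)//.
    by rewrite -[leRHS]expR0 ler_expR oppr_le0 divr_ge0 ?sqn_ge0 ?ltW.
rewrite ge0_integralZr//; last 2 first.
- by move=> p _; rewrite lee_fin gamma_bound_ge0.
- by rewrite lee_fin invr_ge0 mulr_ge0// ltW.
have -> : (\int[@leb2 R]_p (gamma_bound k (x - nsq (toC p + m)))%:E =
    pi%:E * \int[mu]_(u in `[0%R, +oo[) (gamma_bound k (x - u))%:E)%E.
  rewrite -(ge0_integral_polar mh); last by move=> u; rewrite lee_fin gamma_bound_ge0.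
  have mh' := measurableT_comp mh (@measurable_sqn R).
  have h0 (p : RR R) : (0 <= (gamma_bound k (x - sqn p))%:E)%E by rewrite lee_fin gamma_bound_ge0.
  have <- := ge0_integral_translation2 (re_im m) mh' h0.
  by apply: eq_integral => p _; rewrite /nsq re_imD toCK.
rewrite muleC muleA -EFinM invfM mulrAC mulVf ?gt_eqF// mul1r EFinM.
apply: lee_wpmul2l; last exact: integral_gamma_bound.
by rewrite lee_fin invr_ge0 ltW.
Qed.

End ball_bound.

(** * Marginals of independent families, and maps acting on two coordinates *)

Section iid_marginals.
Context d d' (T : measurableType d) (E : measurableType d') (R : realType).
Variables (P : probability T R) (I : finType) (gam : probability E R).
Variables (X : I -> T -> E).
Hypothesis iidX : iid P gam X.
Local Open Scope ereal_scope.

Lemma iid_box (B : I -> set E) : (forall i, measurable (B i)) ->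
  P [set t | forall i, B i (X i t)] = \prod_i gam (B i).
Proof.
move=> mB; rewrite -iidX.2//; congr (P _).
by apply/seteqP; split => [t /= h i _ | t /= h i]; apply: h.
Qed.

Lemma iid_marginal i (D : set E) : measurable D -> P [set t | D (X i t)] = gam D.
Proof.
move=> mD; pose B k := if k == i then D else setT.
rewrite (_ : [set t | _] = [set t | forall k, B k (X k t)]); last first.
  apply/seteqP; split => t /=; rewrite /B; last by move=> /(_ i); rewrite eqxx.
  by move=> Dt k; case: eqP => [->|].
rewrite iid_box; last by move=> k; rewrite /B; case: ifP.
rewrite (bigD1 i)//= {1}/B eqxx big1 ?mule1// => k ki.
by rewrite /B (negbTE ki) probability_setT.
Qed.

Lemma iid_integral i (f : E -> \bar R) : measurable_fun setT f ->
  (forall x, 0 <= f x) -> \int[P]_t f (X i t) = \int[gam]_x f x.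
Proof.
move=> mf f0; have [mX _] := iidX.
have := @ge0_integral_pushforward _ _ _ _ R _ (mX i) P setT f measurableT mf.
rewrite preimage_setT => <-; last by move=> x _.
by apply: eq_measure_integral => A mA _; exact: (iid_marginal i mA).
Qed.

Lemma iid_pair i j (D : set (E * E)) : i != j -> measurable D ->
  P [set t | D (X i t, X j t)] = (gam \x gam) D.
Proof.
move=> ij mD; have [mX _] := iidX.
have mij : measurable_fun setT (fun t => (X i t, X j t)).
  by apply: measurable_fun_pair.
pose m' := measure_function_pushforward__canonical__measure_function_Measure P mij.
rewrite (@product_measure_unique _ _ _ _ _ gam gam m')//.
move=> A B mA mB; rewrite -[LHS]/(P _).
pose C k := if k == i then A else if k == j then B else setT.
rewrite (_ : (fun t => _) @^-1` _ = [set t | forall k, C k (X k t)]); last first.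
  apply/seteqP; split => t /=.
    move=> [/= At Bt] k; rewrite /C; case: eqP => [->|_]//.
    by case: eqP => [->|].
  move=> h; split => /=; first by have := h i; rewrite /C eqxx.
  by have := h j; rewrite /C eqxx eq_sym (negbTE ij).
rewrite iid_box; last by move=> k; rewrite /C; do 2 (case: ifP => //).
rewrite (bigD1 i)//= {1}/C eqxx (bigD1 j)//=; last by rewrite eq_sym.
rewrite {1}/C eqxx eq_sym (negbTE ij) big1 ?mule1// => k /andP[ki kj].
by rewrite /C (negbTE ki) (negbTE kj) probability_setT.
Qed.

Lemma iid_pair_map i j (psi : E * E -> E * E) : i != j ->
  measurable_fun setT psi ->
  (forall D, measurable D -> (gam \x gam) (psi @^-1` D) = (gam \x gam) D) ->
  iid P gam (fun k t => if k == i then (psi (X i t, X j t)).1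
    else if k == j then (psi (X i t, X j t)).2 else X k t).
Proof.
move=> ij mpsi psiP; have [mX _] := iidX.
have mij : measurable_fun setT (fun t => psi (X i t, X j t)).
  by apply: (measurableT_comp mpsi); exact: measurable_fun_pair.
split=> [k|B mB].
  case: (k == i); first exact: (measurableT_comp measurable_fst mij).
  by case: (k == j); first exact: (measurableT_comp measurable_snd mij).
pose D := psi @^-1` (B i `*` B j).
have mD : measurable D.
  by rewrite /D -[X in measurable X]setTI; apply: mpsi => //; exact: measurableX.
pose B' k := if (k == i) || (k == j) then setT else B k.
have mB' k : measurable (B' k) by rewrite /B'; case: ifP.
pose C : set (family_space I E) := [set w | D (w i, w j) /\ forall k, B' k (w k)].
have mC : measurable C.
  apply: measurableI.
    rewrite -[X in measurable X]setTI.
    by apply: (measurable_fun_pair (@measurable_coord _ _ _ i) (@measurable_coord _ _ _ j)).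
  by apply: sub_sigma_algebra; exists B'.
transitivity (P [set t | C (X^~ t)]).
  congr (P _); apply/seteqP; split => t /=.
    move=> h; split.
      split => /=; first by have := h i Logic.I; rewrite /= eqxx.
      by have := h j Logic.I; rewrite /= eqxx eq_sym (negbTE ij).
    move=> k; rewrite /B'; case: ifPn => //; rewrite negb_or => /andP[ki kj].
    by have := h k Logic.I; rewrite /= (negbTE ki) (negbTE kj).
  move=> [[/= hi hj] h] k _ /=.
  case: eqP => [->//|/eqP ki]; case: eqP => [->//|/eqP kj].
  by have := h k; rewrite /B' (negbTE ki) (negbTE kj).
rewrite (decouple iidX (probability_setT gam) [set i; j]%SET mC).
(* With coordinates [i] and [j] frozen, the event is an indicator in [t] times a box in the other
   coordinates, whose probability does not depend on [t]. *)
have E1 t : P [set s | C (mix X [set i; j]%SET t s)] =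
    (\1_[set t | D (X i t, X j t)] t)%:E * \prod_k gam (B' k).
  have mi s : mix X [set i; j]%SET t s i = X i t by rewrite /mix !inE eqxx.
  have mj s : mix X [set i; j]%SET t s j = X j t by rewrite /mix !inE eqxx orbT.
  rewrite indicE; case: (boolP (t \in _)) => [|/negP]; rewrite inE/= => Dt.
    rewrite mul1e -iid_box//; congr (P _); apply/seteqP; split => s /=.
      move=> [_ h] k; have := h k; rewrite /B' /mix !inE.
      by case: ifP.
    move=> h; split; first by rewrite mi mj.
    move=> k; have := h k; rewrite /B' /mix !inE.
    by case: ifP.
  rewrite mul0e (_ : [set s | _] = set0) ?measure0//.
  by apply/seteqP; split => s //= [+ _]; rewrite mi mj.
under eq_integral do rewrite E1.
have mDX : measurable [set t | D (X i t, X j t)].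
  rewrite -[X in measurable X]setTI.
  by apply: (measurable_fun_pair (mX i) (mX j)).
rewrite ge0_integralZr//; last 2 first.
- exact/measurable_EFinP/measurable_indic.
- by apply: prode_ge0 => k _.
have -> : \int[P]_t (\1_[set t | D (X i t, X j t)] t)%:E = gam (B i) * gam (B j).
  rewrite integral_indic// setIT [LHS](iid_pair ij mD).
  rewrite /D psiP; last exact: measurableX.
  exact: product_measure1E.
rewrite (bigD1 i)//= [in RHS](bigD1 i)//= (bigD1 j)//=; last by rewrite eq_sym.
rewrite [in RHS](bigD1 j)//=; last by rewrite eq_sym.
rewrite {1 2}/B' !eqxx orbT !probability_setT !mul1e muleA; congr (_ * _).
by apply: eq_bigr => k /andP[ki kj]; rewrite /B' (negbTE ki) (negbTE kj).
Qed.

End iid_marginals.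

(** * Gaussian vectors: small balls, and one coordinate dominating the others *)

Section gaussian_families.
Context d (T : measurableType d) (R : realType).
Variables (P : probability T R) (v : R).
Hypothesis v0 : 0 < v.

Definition gaussian_family (I : finType) (Z : I -> T -> R[i]) :=
  iid P (cnormal_prob v) (fun i t => re_im (Z i t)).

Lemma gaussian_family_givens (I : finType) (Z : I -> T -> R[i]) (i j : I) (c s : R[i]) :
  gaussian_family Z -> i != j -> nsq c + nsq s = 1 -> s != 0 ->
  gaussian_family (fun k t => if k == i then c * Z i t + s * Z j t
    else if k == j then - s^*%C * Z i t + c^*%C * Z j t else Z k t).
Proof.
move=> hZ ij cs1 s0.
have := iid_pair_map hZ ij (@measurable_givens R c s)
  (fun D => @cnormal_givens R c s v D v0 cs1 s0).
congr (iid _ _ _); apply/funext => k; apply/funext => t.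
by rewrite /givens/= !re_imK; case: ifP => // _; case: ifP.
Qed.

Lemma cmeasurable_coord (I : finType) (i : I) :
  cmeasurable (fun w : family_space I (RR R) => toC (w i)).
Proof.
exact: (cmeasurable_comp (@measurable_coord _ (RR R) I i) (@cmeasurable_toC R)).
Qed.

Lemma measurable_ltr d' (S : measurableType d') (f g : S -> measurableTypeR R) :
  measurable_fun setT f -> measurable_fun setT g ->
  measurable [set w | f w < g w].
Proof.
by move=> mf mg; have := measurable_fun_ltr mf mg => /(_ measurableT [set true]);
  rewrite setTI; apply.
Qed.

Lemma measurable_sum_nsq d' (S : measurableType d') (I : Type) (r : seq I)
    (Q : pred I) (f : I -> S -> R[i]) : (forall i, cmeasurable (f i)) ->
  @measurable_fun _ _ S (measurableTypeR R) setT
    (fun w => \sum_(i <- r | Q i) nsq (f i w)).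
Proof.
move=> mf; under eq_fun do rewrite big_mkcond.
apply: measurable_sum => i; case: (Q i); last exact: measurable_cst.
exact: measurable_nsq.
Qed.
(** Induction on the number of coordinates: freezing coordinate [i] lowers the threshold to
    [x - nsq (Z i t + m i)], and integrating the inductive bound over it raises the power by one and
    yields one more factor [v^-1]. *)
Lemma gaussian_small_ball (I : finType) (Z : I -> T -> R[i]) (K : {set I})
    (m : I -> R[i]) x : gaussian_family Z ->
  (P [set t | (\sum_(i in K) nsq (Z i t + m i) < x)%R] <=
   (v^-1 ^+ #|K| * gamma_bound #|K| x)%:E)%E.
Proof.
move=> hZ; move: {2}#|K| (erefl #|K|) => k; elim: k K x => [|k IH] K x cK.
  move/eqP : (cK); rewrite cards_eq0 => /eqP K0; rewrite {1}K0 cK.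
  (* The empty sum is [0], so the event is empty when [x <= 0] and full otherwise. This is why
     [gamma_bound 0] vanishes at nonpositive arguments instead of being constantly [1]. *)
  rewrite expr0 mul1r /gamma_bound; case: ifPn => x0.
    rewrite (_ : [set t | _] = set0) ?measure0//.
    by apply/seteqP; split => t //=; rewrite big_set0; lra.
  rewrite expr0 fact0 divr1; apply: probability_le1.
  apply: measurable_ltr; last exact: measurable_cst.
  apply: measurable_sum_nsq => j; apply: cmeasurableD; first exact: hZ.1.
  exact: cmeasurable_cst.
have /card_gt0P[i iK] : (0 < #|K|)%N by rewrite cK.
have cK' : #|K :\ i| = k by move: (cardsD1 i K); rewrite iK cK => -[].
pose C : set (family_space I (RR R)) :=
  [set w | \sum_(i in K) nsq (toC (w i) + m i) < x].
have mC : measurable C.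
  apply: measurable_ltr; last exact: measurable_cst.
  apply: measurable_sum_nsq => j; apply: cmeasurableD; first exact: cmeasurable_coord.
  exact: cmeasurable_cst.
rewrite (_ : [set t | _] = [set t | C (fun i => re_im (Z i t))]); last first.
  have E t : \sum_(i in K) nsq (toC (re_im (Z i t)) + m i) = \sum_(i in K) nsq (Z i t + m i).
    by apply: eq_bigr => l _; rewrite re_imK.
  by apply/seteqP; split => t; rewrite /C/= E.
pose h (p : RR R) := (v^-1 ^+ k * gamma_bound k (x - nsq (toC p + m i)))%:E.
have mg : measurable_fun setT
    (fun p : RR R => (gamma_bound k (x - nsq (toC p + m i)))%:E).
  apply/measurable_EFinP; apply: (measurableT_comp (measurable_gamma_bound k)).
  apply: measurable_funB => //; apply: measurable_nsq.
  apply: cmeasurableD; first exact: cmeasurable_toC.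
  exact: cmeasurable_cst.
have mh : measurable_fun setT h.
  rewrite /h; under eq_fun do rewrite EFinM.
  by apply: emeasurable_funM => //; exact: measurable_cst.
have vk0 : 0 <= v^-1 ^+ k by rewrite exprn_ge0// invr_ge0 ltW.
have h0 p : (0 <= h p)%E by rewrite lee_fin mulr_ge0// gamma_bound_ge0.
have step := decouple_le hZ (probability_setT _) (A := [set i]%SET) mC
  (h := fun t => h (re_im (Z i t))).
apply: (le_trans (step _ _)).
- exact: (measurableT_comp mh (hZ.1 i)).
- move=> t; rewrite /h re_imK -{1 2}cK'.
  rewrite (_ : [set s | _] = [set s | \sum_(j in K :\ i) nsq (Z j s + m j) <
     x - nsq (Z i t + m i)]); first exact: IH.
  have E s : \sum_(j in K) nsq (toC (mix (fun i t => re_im (Z i t)) [set i]%SET t s j) + m j) =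
      nsq (Z i t + m i) + \sum_(j in K :\ i) nsq (Z j s + m j).
    rewrite (big_setD1 i)//= {1}/mix !inE eqxx re_imK; congr (_ + _).
    by apply: eq_bigr => j; rewrite /mix !inE => /andP[/negbTE-> _]; rewrite re_imK.
  by apply/seteqP; split => s; rewrite /C/= E -ltrBrDl.
rewrite (iid_integral hZ i mh h0) /h.
under eq_integral do rewrite EFinM.
rewrite ge0_integralZl//; last by move=> p _; rewrite lee_fin gamma_bound_ge0.
apply: (le_trans (lee_wpmul2l _ (integral_cnormal_gamma_bound _ _ _ v0))) => //.
by rewrite cK -EFinM exprSr mulrA.
Qed.

(** The offset [b] serves the induction: freezing coordinate [i] moves [a * nsq (Z i t)] into it,
    and the Laplace transform of [nsq (Z i t)] supplies one factor [(1 + a)^-1]. The base case is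
    the exponential tail of a single coordinate. *)
Lemma gaussian_large_coord (I : finType) (Z : I -> T -> R[i]) (K : {set I}) i0 (a b : R) :
  gaussian_family Z -> i0 \notin K -> 0 <= a -> 0 <= b ->
  ((expR (- (b / v)) / (1 + a) ^+ #|K|)%:E <=
   P [set t | (a * \sum_(i in K) nsq (Z i t) + b < nsq (Z i0 t))%R])%E.
Proof.
move=> hZ; move: {2}#|K| (erefl #|K|) => k.
elim: k K b => [|k IH] K b cK i0K a0 b0.
  move/eqP : (cK); rewrite cards_eq0 => /eqP K0; rewrite cK K0.
  rewrite expr0 divr1 (_ : [set t | _] =
    [set t | [set p : RR R | b < sqn p] (re_im (Z i0 t))]); last first.
    by apply/seteqP; split => t; rewrite /= big_set0 mulr0 add0r.
  rewrite (iid_marginal hZ) ?cnormal_sqn_gt//.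
  by apply: measurable_ltr; [exact: measurable_cst|exact: measurable_sqn].
have /card_gt0P[i iK] : (0 < #|K|)%N by rewrite cK.
have cK' : #|K :\ i| = k by move: (cardsD1 i K); rewrite iK cK => -[].
pose C : set (family_space I (RR R)) :=
  [set w | a * \sum_(i in K) nsq (toC (w i)) + b < nsq (toC (w i0))].
have mC : measurable C.
  apply: measurable_ltr; last by apply: measurable_nsq; exact: cmeasurable_coord.
  apply: measurable_funD => //; apply: measurable_funM => //.
  by apply: measurable_sum_nsq => j; exact: cmeasurable_coord.
rewrite (_ : [set t | _] = [set t | C (fun i => re_im (Z i t))]); last first.
  have E t : \sum_(i in K) nsq (toC (re_im (Z i t))) = \sum_(i in K) nsq (Z i t).
    by apply: eq_bigr => l _; rewrite re_imK.
  by apply/seteqP; split => t; rewrite /C/= E re_imK.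
pose h (p : RR R) := ((expR (- ((a * nsq (toC p) + b) / v)) / (1 + a) ^+ k)%:E).
have mg : measurable_fun setT (fun p : RR R => (expR (- (a * sqn p / v)))%:E).
  apply/measurable_EFinP/measurableT_comp => //; apply: measurableT_comp => //.
  apply: measurable_funM => //; apply: measurable_funM => //; exact: measurable_sqn.
pose c := expR (- (b / v)) / (1 + a) ^+ k.
have c0 : 0 <= c.
  by rewrite divr_ge0 ?expR_ge0// exprn_ge0//; lra.
have hE p : h p = (c%:E * (expR (- (a * sqn p / v)))%:E)%E.
  rewrite /h /c /nsq toCK -EFinM; congr EFin.
  by rewrite mulrDl opprD expRD; ring.
have mh : measurable_fun setT h.
  rewrite (funext hE).
  by apply: emeasurable_funM => //; exact: measurable_cst.
have h0 p : (0 <= h p)%E by rewrite hE mule_ge0// lee_fin expR_ge0.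
apply: (le_trans _ (decouple_ge hZ (probability_setT _) (A := [set i]%SET) mC
  (h := fun t => h (re_im (Z i t))) _ _ _)).
- rewrite (iid_integral hZ i mh h0); under eq_integral do rewrite hE.
  rewrite ge0_integralZl// cnormal_laplace// -EFinM lee_fin cK /c exprSr invfM mulrA.
  by [].
- exact: (measurableT_comp mh (hZ.1 i)).
- by move=> t.
- move=> t; rewrite /h re_imK -{1}cK'.
  rewrite (_ : [set s | _] = [set s | a * (\sum_(j in K :\ i) nsq (Z j s)) +
     (a * nsq (Z i t) + b) < nsq (Z i0 s)]).
    apply: IH => //; first by rewrite inE negb_and i0K orbT.
    by rewrite addr_ge0// mulr_ge0// nsq_ge0.
  have E s : \sum_(j in K) nsq (toC (mix (fun i t => re_im (Z i t)) [set i]%SET t s j)) =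
      nsq (Z i t) + \sum_(j in K :\ i) nsq (Z j s).
    rewrite (big_setD1 i)//= {1}/mix !inE eqxx re_imK; congr (_ + _).
    by apply: eq_bigr => j; rewrite /mix !inE => /andP[/negbTE-> _]; rewrite re_imK.
  have i0i : i0 != i by apply: contraNneq i0K => ->.
  apply/seteqP; split => s; rewrite /C/= E {1}/mix !inE (negbTE i0i) re_imK; lra.
Qed.

End gaussian_families.

(** * Unitary matrices built from Givens rotations, and triangularisation *)

Section unitary.
Context (R : realType).
Local Notation C := R[i].

Lemma conjCE (z : C) : Num.conj z = z^*%C. Proof. by []. Qed.

Definition rnsq n (y : 'rV[C]_n) : R := \sum_j nsq (y 0 j).
Definition cnsq n (w : 'cV[C]_n) : R := \sum_i nsq (w i 0).

Lemma rnsqE n (y : 'rV[C]_n) : (y *m y^t*) 0 0 = (rnsq y)%:C%C.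
Proof.
rewrite !mxE rmorph_sum/=; apply: eq_bigr => j _.
by rewrite !mxE conjCE nsq_real.
Qed.

Lemma cnsqE n (w : 'cV[C]_n) : (w^t* *m w) 0 0 = (cnsq w)%:C%C.
Proof.
rewrite !mxE rmorph_sum/=; apply: eq_bigr => j _.
by rewrite !mxE conjCE mulrC nsq_real.
Qed.

Lemma rnsq_ge0 n (y : 'rV[C]_n) : 0 <= rnsq y.
Proof. by apply: sumr_ge0 => j _; exact: nsq_ge0. Qed.

Lemma rnsq_eq0 n (y : 'rV[C]_n) : (rnsq y == 0) = (y == 0).
Proof.
rewrite psumr_eq0; last by move=> j _; exact: nsq_ge0.
apply/allP/eqP => [h|-> j _]; last by rewrite mxE /= nsq0.
apply/rowP => j; rewrite mxE; apply/eqP; rewrite -nsq_eq0.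
exact: (h j (mem_index_enum _)).
Qed.

Lemma trmxC_mul m n p (A : 'M[C]_(m, n)) (B : 'M[C]_(n, p)) :
  (A *m B)^t* = B^t* *m A^t*.
Proof. by rewrite trmx_mul map_mxM. Qed.

Lemma unitary_trC_mul n (V : 'M[C]_n) : V \is unitarymx -> V^t* *m V = 1%:M.
Proof. by rewrite -trmxC_unitary => /unitarymxP; rewrite trmxCK. Qed.

Lemma unitary_cnsq n (V : 'M[C]_n) w : V \is unitarymx -> cnsq (V *m w) = cnsq w.
Proof.
move=> uV; apply: (@complexI R); rewrite -!cnsqE trmxC_mul.
by rewrite -(mulmxA (w^t*) (V^t*)) (mulmxA (V^t*) V w) unitary_trC_mul// mul1mx.
Qed.

Lemma unitary_rnsq n (V : 'M[C]_n) y : V \is unitarymx -> rnsq (y *m V^t*) = rnsq y.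
Proof.
move=> uV; apply: (@complexI R); rewrite -!rnsqE trmxC_mul trmxCK.
by rewrite mulmxA -(mulmxA _ (V^t*) V) unitary_trC_mul// mulmx1.
Qed.

Definition givens_mx n (i j : 'I_n) (c s : C) : 'M[C]_n :=
  \matrix_(a, b) if a == i then c * (b == i)%:R + s * (b == j)%:R
    else if a == j then - s^*%C * (b == i)%:R + c^*%C * (b == j)%:R
    else (b == a)%:R.

Lemma sum_delta n q (A : 'M[C]_(n, q)) i b : \sum_k (k == i)%:R * A k b = A i b.
Proof.
rewrite (bigD1 i)//= eqxx mul1r big1 ?addr0// => k /negbTE->.
by rewrite mul0r.
Qed.

Lemma givens_mxE n q (i j : 'I_n) c s (A : 'M[C]_(n, q)) a b :
  (givens_mx i j c s *m A) a b = if a == i then c * A i b + s * A j b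
    else if a == j then - s^*%C * A i b + c^*%C * A j b else A a b.
Proof.
rewrite mxE; case: ifPn => ai.
  under eq_bigr do rewrite mxE ai mulrDl -!mulrA.
  by rewrite big_split/= -!mulr_sumr !sum_delta.
case: ifPn => aj.
  under eq_bigr do rewrite mxE (negbTE ai) aj mulrDl -!mulrA.
  by rewrite big_split/= -!mulr_sumr !sum_delta.
under eq_bigr do rewrite mxE (negbTE ai) (negbTE aj).
exact: sum_delta.
Qed.

Lemma givens_unitary n (i j : 'I_n) c s : i != j -> nsq c + nsq s = 1 ->
  givens_mx i j c s \is unitarymx.
Proof.
move=> ij cs1; apply/unitarymxP.
have h : c * c^*%C + s * s^*%C = 1 by rewrite !nsq_real -rmorphD/= cs1.
have hc k l : (givens_mx i j c s)^t* k l =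
    if l == i then c^*%C * (k == i)%:R + s^*%C * (k == j)%:R
    else if l == j then - s * (k == i)%:R + c * (k == j)%:R else (k == l)%:R.
  rewrite !mxE conjCE; case: ifP => _; first by rewrite rmorphD !rmorphM/= !conjc_nat.
  case: ifP => _; last by rewrite conjc_nat.
  by rewrite rmorphD !rmorphM/= !conjc_nat rmorphN/= !conjcK.
apply/matrixP => a b; rewrite givens_mxE !hc !mxE.
have ji : (j == i) = false by rewrite eq_sym (negbTE ij).
rewrite !eqxx (negbTE ij) ji.
case: (eqVneq a i) => [->|ai].
  case: (eqVneq b i) => [E|bi]; first by rewrite ?E ?eqxx /=; transitivity (c * c^*%C + s * s^*%C);
      [ring|rewrite h].
  case: (eqVneq b j) => [E|bj]; first by rewrite ?E ?(negbTE ij) /=; ring.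
  by rewrite !mulr0 addr0.
case: (eqVneq a j) => [->|aj].
  case: (eqVneq b i) => [E|bi]; first by rewrite ?E ?ji /=; ring.
  case: (eqVneq b j) => [E|bj]; first by rewrite ?E ?eqxx /=; transitivity (c * c^*%C + s * s^*%C);
      [ring|rewrite h].
  by rewrite !mulr0 addr0.
case: (eqVneq b i) => [E|bi]; first by rewrite ?E ?(negbTE ai) !mulr0 addr0.
by case: (eqVneq b j) => [E|bj] //; rewrite ?E ?(negbTE aj) !mulr0 addr0.
Qed.

End unitary.

Section gaussian_matrix.
Context d (T : measurableType d) (R : realType).
Variables (P : probability T R) (v : R).
Hypothesis v0 : 0 < v.
Local Notation C := R[i].

Definition gaussian_mx n q (G : T -> 'M[C]_(n, q)) :=
  gaussian_family P v (fun (ij : 'I_n * 'I_q) t => G t ij.1 ij.2).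

Lemma gaussian_family_ext (I : finType) (Z Z' : I -> T -> C) :
  (forall i t, Z i t = Z' i t) -> gaussian_family P v Z -> gaussian_family P v Z'.
Proof.
by move=> e; have -> : Z = Z' by apply/funext => i; apply/funext => t; exact: e.
Qed.

(** In each column a Givens matrix rotates one pair of independent entries. The columns are treated
    one at a time, [W m] being the family after the first [m] of them. *)
Lemma gaussian_mx_givens n q (G : T -> 'M[C]_(n, q)) (i j : 'I_n) c s :
  gaussian_mx G -> i != j -> nsq c + nsq s = 1 -> s != 0 ->
  gaussian_mx (fun t => givens_mx i j c s *m G t).
Proof.
move=> hG ij cs1 s0.
pose W (m : nat) (ab : 'I_n * 'I_q) t :=
  if (ab.2 < m)%N then (givens_mx i j c s *m G t) ab.1 ab.2 else G t ab.1 ab.2.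
suff h m : (m <= q)%N -> gaussian_family P v (W m).
  by apply: gaussian_family_ext (h q (leqnn _)) => ab t; rewrite /W ltn_ord.
elim: m => [|m IH] mq; first exact: hG.
pose b0 := Ordinal mq.
have ij0 : (i, b0) != (j, b0) by apply: contra_neq ij => -[].
apply: gaussian_family_ext (gaussian_family_givens v0 (IH (ltnW mq)) ij0 cs1 s0) => -[a b] t.
rewrite /W /= !ltnn !xpair_eqE (_ : (b < m.+1)%N = (b == m :> nat) || (b < m)%N); last first.
  by rewrite ltnS leq_eqVlt.
have -> : (b == b0) = (b == m :> nat) by [].
have [bm|bm] /= := eqVneq (b : nat) m; last by rewrite !andbF.
have -> : b = b0 by apply: val_inj.
by rewrite !andbT givens_mxE ltnn.
Qed.

(** A property carried along products of Givens rotations, from which all the unitary matrices used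
    below are made. The width [q] is quantified so that the same [V] acts on single columns and on
    whole matrices. *)
Definition preserves_gaussian n (V : 'M[C]_n) :=
  V \is unitarymx /\ forall q (G : T -> 'M[C]_(n, q)), gaussian_mx G ->
    gaussian_mx (fun t => V *m G t).

Lemma preserves_gaussian1 n : preserves_gaussian (1%:M : 'M[C]_n).
Proof.
split=> [|q G hG]; first by apply/unitarymxP; rewrite mul1mx trmx1 map_mx1.
by apply: gaussian_family_ext hG => -[a b] t; rewrite mul1mx.
Qed.

Lemma preserves_gaussian_mul n (V W : 'M[C]_n) :
  preserves_gaussian V -> preserves_gaussian W -> preserves_gaussian (V *m W).
Proof.
move=> [uV hV] [uW hW]; split=> [|q G hG]; first exact: (mul_unitarymx uV uW).
by apply: gaussian_family_ext (hV _ _ (hW _ _ hG)) => -[a b] t; rewrite mulmxA.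
Qed.

(* [V] is the direct sum of the identity of size [k] and some square block. *)
Definition fixes_above n (k : nat) (V : 'M[C]_n) :=
  forall q (A : 'M[C]_(n, q)),
    (forall (l : 'I_n) b, (l < k)%N -> (V *m A) l b = A l b) /\
    (forall b, (forall l : 'I_n, (k <= l)%N -> A l b = 0) ->
       forall l : 'I_n, (k <= l)%N -> (V *m A) l b = 0).

(** One Givens rotation per entry below [i0], in the plane of coordinates [i0] and [j]; the other
    rows do not move, so entries cleared before stay zero. *)
Lemma clear_column n (w : 'cV[C]_n) (i0 : 'I_n) : exists V : 'M[C]_n,
  [/\ preserves_gaussian V, fixes_above i0 V &
    forall l : 'I_n, (i0 < l)%N -> (V *m w) l 0 = 0].
Proof.
suff h (r : seq 'I_n) : all (fun l : 'I_n => (i0 < l)%N) r -> exists V : 'M[C]_n,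
    [/\ preserves_gaussian V, fixes_above i0 V & forall l, l \in r -> (V *m w) l 0 = 0].
  have [|V [gV fV zV]] := h [seq l : 'I_n <- enum 'I_n | (i0 < l)%N].
    exact: filter_all.
  exists V; split => // l il; apply: zV.
  by rewrite mem_filter il mem_enum.
elim: r => [_|j r IH /= /andP[ij rP]].
  exists 1%:M; split => //; first exact: preserves_gaussian1.
  by move=> q A; rewrite mul1mx; split.
have [V [gV fV zV]] := IH rP.
(* An entry that is already zero is skipped: it would give [s = 0], which the factorisation into
   shears excludes. *)
have [wj|wj] := eqVneq ((V *m w) j 0) 0.
  exists V; split => // l; rewrite inE => /predU1P[->//|]; exact: zV.
pose x := (V *m w) i0 0; pose y := (V *m w) j 0.
have y0 : 0 < nsq y by rewrite lt_neqAle nsq_ge0 eq_sym nsq_eq0 wj.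
have xy0 : 0 < nsq x + nsq y by rewrite ltr_wpDl ?nsq_ge0.
pose rho := Num.sqrt (nsq x + nsq y).
have rho0 : rho != 0 by rewrite gt_eqF// sqrtr_gt0.
have rhoC0 : rho%:C%C != 0 :> C by rewrite fmorph_eq0.
pose c : C := x^*%C / rho%:C%C; pose s : C := y^*%C / rho%:C%C.
have nconj (z : C) : nsq z^*%C = nsq z by case: z => a b; rewrite !nsqE/= sqrrN.
have nrho : nsq rho%:C%C = nsq x + nsq y.
  by rewrite nsqE/= expr0n addr0 sqr_sqrtr// ltW.
have cs1 : nsq c + nsq s = 1.
  by rewrite !nsqM !nsqV !nconj nrho -mulrDl divff// gt_eqF.
have s0 : s != 0.
  by rewrite mulf_neq0 ?invr_eq0// fmorph_eq0.
have ij' : i0 != j by apply: contraTneq ij => ->; rewrite ltnn.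
have gG : preserves_gaussian (givens_mx i0 j c s).
  split; first exact: givens_unitary.
  by move=> q G hG; exact: gaussian_mx_givens.
exists (givens_mx i0 j c s *m V); split; first exact: preserves_gaussian_mul.
  move=> q A; have [fV1 fV2] := fV q A; split => [l b li|b A0 l li].
    rewrite -mulmxA givens_mxE !ifF ?fV1//.
      by apply/negbTE; apply: contraTneq li => ->; rewrite -leqNgt ltnW.
    by apply/negbTE; apply: contraTneq li => ->; rewrite ltnn.
  rewrite -mulmxA givens_mxE !(fV2 b A0)// ?(ltnW ij)//.
  by case: ifP => _; [|case: ifP => _]; rewrite ?mulr0 ?addr0.
move=> l; rewrite inE -mulmxA givens_mxE => /predU1P[->|lr].
  rewrite eq_sym (negbTE ij') eqxx -/x -/y /s /c !rmorphM !fmorphV/= !conjcK oppr0.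
  by rewrite -/(rho%:C%C); field; exact: rhoC0.
have il : (i0 < l)%N by exact: (allP rP _ lr).
rewrite ifF; last by apply/negbTE; apply: contraTneq il => ->; rewrite ltnn.
by case: ifPn => [/eqP lj|_]; [move: wj; rewrite -lj zV// eqxx|exact: zV].
Qed.

(** Columns are cleared from left to right. The rotation for column [k] fixes the rows above [k] and
    acts on zeros in the earlier columns, whose triangular shape therefore survives. *)
Lemma gaussian_QR n m (A : 'M[C]_(n, m)) : exists2 V : 'M[C]_n,
  preserves_gaussian V & forall (l : 'I_n) (b : 'I_m), (b < l)%N -> (V *m A) l b = 0.
Proof.
suff h k : (k <= m)%N -> exists2 V : 'M[C]_n, preserves_gaussian V &
    forall (l : 'I_n) (b : 'I_m), (b < k)%N -> (b < l)%N -> (V *m A) l b = 0.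
  by have [V gV zV] := h m (leqnn m); exists V => // l b bl; apply: zV.
elim: k => [_|k IH km]; first by exists 1%:M => //; exact: preserves_gaussian1.
have [V gV zV] := IH (ltnW km).
(* A column of index at least [n] has no entry below the diagonal, and no row could serve as its
   pivot. *)
have [kn|nk] := ltnP k n; last first.
  exists V => // l b; rewrite ltnS leq_eqVlt => /predU1P[-> kl|]; last exact: zV.
  by have := leq_trans (ltn_ord l) nk; rewrite ltnNge (ltnW kl).
have [W [gW fW zW]] := clear_column (col (Ordinal km) (V *m A)) (Ordinal kn).
exists (W *m V); first exact: preserves_gaussian_mul.
move=> l b; rewrite ltnS leq_eqVlt => /predU1P[bk bl|bk bl].
  have kl : (k < l)%N by rewrite -bk.
  have -> : b = Ordinal km by exact: val_inj.
  rewrite -mulmxA -[RHS](zW l kl) [LHS]mxE [RHS]mxE.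
  by apply: eq_bigr => i _; rewrite [in RHS]mxE.
have [f1 f2] := fW _ (V *m A); rewrite -mulmxA.
have [lk|kl] := ltnP l k; first by rewrite f1// zV.
by apply: f2 => // l' kl'; apply: zV => //; exact: leq_trans kl'.
Qed.

End gaussian_matrix.

(** * Measurability of events that ask for the existence of a row vector *)

Section rational_witness.
Context (R : realType) (n : nat).
Local Notation C := R[i].

(** Real coordinates on complex row vectors, which make the topology of real matrices and the
    density of rational ones available. *)
Definition rowC (M : 'M[R]_(n, 2)) : 'rV[C]_n :=
  \row_i Complex (M i 0) (M i 1).

Lemma rowC_surj (y : 'rV[C]_n) : exists M, rowC M = y.
Proof.
exists (\matrix_(i, j) if j == 0 then complex.Re (y 0 i) else complex.Im (y 0 i)).
by apply/rowP => i; rewrite !mxE; case: (y 0 i).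
Qed.

Lemma open_rational (U : set 'M[R]_(n, 2)) M : open U -> U M ->
  exists q : 'M[rat]_(n, 2), U (map_mx ratr q).
Proof.
rewrite openE => oU /oU; rewrite /interior -nbhs_ballE => -[e /= e0 eU].
have h i j : exists q : rat, ball (M i j) e (ratr q).
  have /rat_in_itvoo[q] : M i j - e < M i j + e by rewrite ltrBlDr -addrA ltrDl addr_gt0.
  by rewrite in_itv/= => hq; exists q; rewrite /ball/= ltr_distlC.
have [f hf] := choice (fun ij : 'I_n * 'I_2 => h ij.1 ij.2).
exists (\matrix_(i, j) f (i, j)); apply: eU; split => // i j.
by rewrite !mxE; exact: (hf (i, j)).
Qed.

(* An open condition on [y] that can be met can be met by a rational [y], so the
   uncountable union over [y] is a countable one. *)
Lemma measurable_exists_row d (S : measurableType d)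
    (Q : S -> set 'rV[C]_n) :
  (forall y, measurable [set s | Q s y]) ->
  (forall s, open (rowC @^-1` (Q s))) ->
  measurable [set s | exists y, Q s y].
Proof.
move=> mQ oQ.
rewrite (_ : [set s | _] =
    \bigcup_(q : 'M[rat]_(n, 2)) [set s | Q s (rowC (map_mx ratr q))]).
  by apply: countable_bigcupT_measurable => // q; exact: mQ.
apply/seteqP; split => s /=.
  move=> [y Qy]; have [M My] := rowC_surj y.
  have [|q Qq] := @open_rational _ M (oQ s); first by rewrite /= My.
  by exists q.
by move=> [q _ Qq]; exists (rowC (map_mx ratr q)).
Qed.

Definition ccontinuous (f : 'M[R]_(n, 2) -> C) :=
  continuous (fun M => complex.Re (f M)) /\ continuous (fun M => complex.Im (f M)).

Lemma ccontinuous_row i : ccontinuous (fun M => rowC M 0 i).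
Proof.
split.
  rewrite (_ : (fun M => _) = (fun M : 'M[R]_(n, 2) => M i 0)).
    exact: coord_continuous.
  by apply/funext => M; rewrite mxE.
rewrite (_ : (fun M => _) = (fun M : 'M[R]_(n, 2) => M i 1)).
  exact: coord_continuous.
by apply/funext => M; rewrite mxE.
Qed.

Lemma ccontinuousMr f (c : C) : ccontinuous f -> ccontinuous (fun M => f M * c).
Proof.
case: c => a b [c1 c2]; split.
  rewrite (_ : (fun M => _) = (fun M => complex.Re (f M) * a - complex.Im (f M) * b)).
    by move=> M; exact: (cvgB (cvgM (c1 M) (cvg_cst a)) (cvgM (c2 M) (cvg_cst b))).
  by apply/funext => M; case: (f M).
rewrite (_ : (fun M => _) = (fun M => complex.Re (f M) * b + complex.Im (f M) * a)).
  by move=> M; exact: (cvgD (cvgM (c1 M) (cvg_cst b)) (cvgM (c2 M) (cvg_cst a))).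
by apply/funext => M; case: (f M).
Qed.

Lemma ccontinuous_sum (I : Type) (s : seq I) (h : I -> 'M[R]_(n, 2) -> C) :
  (forall i, ccontinuous (h i)) -> ccontinuous (fun M => \sum_(i <- s) h i M).
Proof.
move=> mh; elim: s => [|i s [IH1 IH2]].
  by under eq_fun do rewrite big_nil; split; exact: cst_continuous.
under eq_fun do rewrite big_cons; have [h1 h2] := mh i; split.
  rewrite (_ : (fun M => _) = (fun M => complex.Re (h i M) + complex.Re (\sum_(j <- s) h j M))).
    by move=> M; exact: (cvgD (h1 M) (IH1 M)).
  by apply/funext => M; case: (h i M) (\sum_(j <- s) _) => [? ?] [].
rewrite (_ : (fun M => _) = (fun M => complex.Im (h i M) + complex.Im (\sum_(j <- s) h j M))).
  by move=> M; exact: (cvgD (h2 M) (IH2 M)).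
by apply/funext => M; case: (h i M) (\sum_(j <- s) _) => [? ?] [].
Qed.

Lemma continuous_nsq f : ccontinuous f -> continuous (fun M => nsq (f M)).
Proof.
move=> [c1 c2] M.
have c x : {for x, continuous (fun x : R => x ^+ 2)} by exact: exprn_continuous.
exact: (cvgD (continuous_comp (c1 M) (c _)) (continuous_comp (c2 M) (c _))).
Qed.

Lemma ccontinuous_mulmx q (A : 'M[C]_(n, q)) j :
  ccontinuous (fun M => (rowC M *m A) 0 j).
Proof.
under eq_fun do rewrite mxE.
by apply: ccontinuous_sum => i; apply: ccontinuousMr; exact: ccontinuous_row.
Qed.

Lemma continuous_rnsq q (A : 'M[C]_(n, q)) :
  continuous (fun M => rnsq (rowC M *m A)).
Proof.
rewrite /rnsq.
elim: (index_enum _) => [|j r IH].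
  by under eq_fun do rewrite big_nil; exact: cst_continuous.
under eq_fun do rewrite big_cons.
move=> M; apply: (cvgD _ (IH M)).
exact: (continuous_nsq (ccontinuous_mulmx A j)).
Qed.

Lemma continuous_cstM (x : R) (f : 'M[R]_(n, 2) -> R) : continuous f ->
  continuous (fun M => x * f M).
Proof. by move=> cf M; exact: (cvgM (cvg_cst x) (cf M)). Qed.

Lemma open_ltr (f g : 'M[R]_(n, 2) -> R) : continuous f -> continuous g ->
  open [set M | f M < g M].
Proof.
move=> cf cg; rewrite (_ : [set M | _] = (fun M => g M - f M) @^-1` [set x | 0 < x]).
  apply: open_comp; last exact: open_gt.
  by move=> M _; exact: (cvgB (cg M) (cf M)).
by apply/seteqP; split => M /=; rewrite subr_gt0.
Qed.

End rational_witness.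

Section measurable_matrix.
Context d (S : measurableType d) (R : realType).
Local Notation C := R[i].

Definition measurable_mx n q (G : S -> 'M[C]_(n, q)) :=
  forall i j, cmeasurable (fun t => G t i j).

Lemma measurable_mx_cst n q (A : 'M[C]_(n, q)) : measurable_mx (fun _ => A).
Proof. by move=> i j; exact: cmeasurable_cst. Qed.

Lemma measurable_mxD n q (G H : S -> 'M[C]_(n, q)) :
  measurable_mx G -> measurable_mx H -> measurable_mx (fun t => G t + H t).
Proof.
move=> mG mH i j; under eq_fun do rewrite mxE.
exact: cmeasurableD.
Qed.

Lemma measurable_mxM n q r (G : S -> 'M[C]_(n, q)) (H : S -> 'M[C]_(q, r)) :
  measurable_mx G -> measurable_mx H -> measurable_mx (fun t => G t *m H t).
Proof.
move=> mG mH i j; under eq_fun do rewrite mxE.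
by apply: cmeasurable_sum => k; exact: cmeasurableM.
Qed.

Lemma measurable_rnsq n (G : S -> 'rV[C]_n) : measurable_mx G ->
  @measurable_fun _ _ S (measurableTypeR R) setT (fun t => rnsq (G t)).
Proof. by move=> mG; apply: measurable_sum_nsq. Qed.

Lemma measurable_cnsq n (G : S -> 'cV[C]_n) : measurable_mx G ->
  @measurable_fun _ _ S (measurableTypeR R) setT (fun t => cnsq (G t)).
Proof. by move=> mG; apply: measurable_sum_nsq. Qed.

End measurable_matrix.

Lemma measurable_mix d d' (T : measurableType d) (E : measurableType d')
    (I : finType) (X : I -> T -> E) (A : {set I}) (Q : set (family_space I E)) t :
  (forall i, measurable_fun setT (X i)) -> measurable Q ->
  measurable [set s | Q (mix X A t s)].
Proof.
move=> mX mQ; have := @measurable_family _ E I _ T (fun i s => mix X A t s i).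
move=> /(_ _ measurableT _ mQ); rewrite setTI; apply => i.
by rewrite /mix; case: (i \in A) => //; exact: measurable_cst.
Qed.

(** * The distance from one row to the span of the others *)

Section gaussian_events.
Context d (T : measurableType d) (R : realType).
Variables (P : probability T R) (v : R).
Hypothesis v0 : 0 < v.
Local Notation C := R[i].

(** Indices outside the image of [f] are given the full space and contribute factors [1]. This
    extracts a single row or column from a Gaussian matrix. *)
Lemma gaussian_family_reindex (I J : finType) (f : J -> I) (Z : I -> T -> C) :
  injective f -> gaussian_family P v Z -> gaussian_family P v (fun j t => Z (f j) t).
Proof.
move=> fI hZ; split=> [j|B mB]; first exact: (hZ.1 (f j)).
pose B' i := if [pick j | f j == i] is Some j then B j else setT.
have B'f j : B' (f j) = B j.
  rewrite /B'; case: pickP => [j' /eqP /fI->//|/(_ j)].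
  by rewrite eqxx.
have B'T i : i \notin codom f -> B' i = setT.
  rewrite /B'; case: pickP => // j /eqP <-; by rewrite codom_f.
have mB' i : measurable (B' i) by rewrite /B'; case: pickP.
transitivity (P (\bigcap_(i in [set: I]) ((fun t => re_im (Z i t)) @^-1` B' i))).
  congr (P _); apply/seteqP; split => t /= h.
    move=> i _; rewrite /= /B'; case: pickP => // j /eqP <-; exact: h.
  by move=> j _; have := h (f j) Logic.I; rewrite /= B'f.
rewrite hZ.2// (bigID (fun i => i \in codom f))/= [X in (_ * X)%E]big1 ?mule1; last first.
  by move=> i /B'T ->; rewrite probability_setT.
rewrite (eq_bigl (fun i => i \in [set f j | j in [set: J]%SET]%SET)); last first.
  by move=> i; apply/codomP/imsetP => -[j]; [exists j; rewrite ?inE|move=> _ ->; exists j].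
rewrite big_imset/=; last by move=> j j' _ _; exact: fI.
by apply: eq_big => [j|j _]; [rewrite inE|rewrite B'f].
Qed.

Lemma gaussian_measurable_mx n q (G : T -> 'M[C]_(n, q)) :
  gaussian_mx P v G -> measurable_mx G.
Proof. by move=> hG i j; exact: (hG.1 (i, j)). Qed.

(* Dividing by [y 0 0], the event says that the first row of [M + G] is within
   [sqrt x] of the span of the others.  Once these are frozen, rotating their span
   into the first [n'] coordinates leaves [N - n'] Gaussian coordinates to be small. *)
Lemma small_distance n' N (M : 'M[C]_(n'.+1, N)) (G : T -> 'M[C]_(n'.+1, N)) (x : R) :
  gaussian_mx P v G -> (n' <= N)%N ->
  (P [set t | exists y : 'rV[C]_n'.+1, (rnsq (y *m (M + G t)) < x * nsq (y 0 0))%R] <=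
   (v^-1 ^+ (N - n') * gamma_bound (N - n') x)%:E)%E.
Proof.
move=> hG nN.
pose I : finType := ('I_n'.+1 * 'I_N)%type.
pose mat (w : I -> RR R) : 'M[C]_(n'.+1, N) := \matrix_(i, j) toC (w (i, j)).
pose Q : set (family_space I (RR R)) :=
  [set w | exists y : 'rV[C]_n'.+1, rnsq (y *m (M + mat w)) < x * nsq (y 0 0)].
have mmat : measurable_mx (fun w : family_space I (RR R) => mat w).
  move=> i j; have := @cmeasurable_coord R I (i, j).
  by congr cmeasurable; apply/funext => w; rewrite mxE.
have mQ : measurable Q.
  apply: measurable_exists_row => [y|w].
    apply: measurable_ltr; last exact: measurable_cst.
    apply: measurable_rnsq; apply: measurable_mxM; first exact: measurable_mx_cst.
    by apply: measurable_mxD => //; exact: measurable_mx_cst.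
  apply: open_ltr; first exact: continuous_rnsq.
  by apply: continuous_cstM; apply: continuous_nsq; exact: ccontinuous_row.
have matE t : mat (fun ij => re_im (G t ij.1 ij.2)) = G t.
  by apply/matrixP => i j; rewrite mxE re_imK.
rewrite (_ : [set t | _] = [set t | Q (fun ij => re_im (G t ij.1 ij.2))]); last first.
  by apply/seteqP; split => t; rewrite /Q/= matE.
(* [mix] keeps every row but the first, which is resampled. *)
pose A : {set I} := [set ij : I | ij.1 != 0]%SET.
set c := _%:E.
apply: (le_trans (decouple_le hG (probability_setT _) (A := A) mQ (h := cst c) _ _)).
- exact: measurable_cst.
- move=> t /=.
  pose B := M + G t.
  pose S : 'M[C]_(N, n') := \matrix_(l, j) B (lift ord0 j) l.
  have [V [uV hV] zV] := gaussian_QR P v0 S.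
  pose g s : 'cV[C]_N := \col_l G s 0 l.
  pose m : 'cV[C]_N := \col_l M 0 l.
  have hg : gaussian_mx P v g.
    have fI : injective (fun l : 'I_N * 'I_1 => ((0 : 'I_n'.+1), l.1)).
      by move=> [l a] [l' a'] [->]; rewrite (ord1 a) (ord1 a').
    by apply: gaussian_family_ext (gaussian_family_reindex fI hG) => -[l a] s; rewrite mxE.
  have hVg : gaussian_family P v (fun l s => (V *m g s) l 0).
    have fI : injective (fun l : 'I_N => (l, 0 : 'I_1)) by move=> l l' [].
    exact: (gaussian_family_reindex fI (hV _ _ hg)).
  pose K : {set 'I_N} := [set l : 'I_N | (n' <= l)%N]%SET.
  have cK : #|K| = (N - n')%N.
    rewrite -sum1_card (eq_bigl (fun l : 'I_N => true && (n' <= l)%N)).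
      by rewrite -(big_geq_mkord n' N xpredT (fun=> 1%N)) sum_nat_const_nat muln1.
    by move=> l; rewrite inE.
  have := gaussian_small_ball v0 K (fun l => (V *m m) l 0) x hVg; rewrite cK.
  apply: le_trans; apply: le_measure; rewrite ?inE.
  + by apply: (measurable_mix _ _ hG.1 mQ).
  + apply: measurable_ltr; last exact: measurable_cst.
    apply: measurable_sum_nsq => l; apply: cmeasurableD; first exact: (hVg.1 l).
    exact: cmeasurable_cst.
  move=> s [y /=]; set W := mat _ => hy.
  have W0 l : W 0 l = G s 0 l by rewrite mxE /mix inE/= ?eqxx re_imK.
  have Wj j l : W (lift ord0 j) l = G t (lift ord0 j) l by rewrite mxE /mix inE/= re_imK.
  clearbody W.
  pose y0 := y 0 0.
  have y00 : y0 != 0.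
    apply: contraTneq hy => y00; rewrite -leNgt -/y0 y00 nsq0 mulr0.
    exact: rnsq_ge0.
  pose z : 'cV[C]_n' := \col_j (y 0 (lift ord0 j) / y0).
  pose w : 'cV[C]_N := m + g s + S *m z.
  have wE l : w l 0 = y0^-1 * (y *m (M + W)) 0 l.
    rewrite !mxE big_ord_recl mulrDr -/y0 mulKf// !mxE W0; congr (_ + _).
    rewrite mulr_sumr; apply: eq_bigr => j _.
    by rewrite !mxE Wj mulrC; ring.
  have cw : cnsq w < x.
    have -> : cnsq w = (nsq y0)^-1 * rnsq (y *m (M + W)).
      by rewrite /cnsq /rnsq mulr_sumr; apply: eq_bigr => l _; rewrite wE nsqM nsqV.
    by rewrite mulrC ltr_pdivrMr// lt_neqAle nsq_ge0 eq_sym nsq_eq0 y00.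
  apply: le_lt_trans cw; rewrite -(unitary_cnsq w uV) /cnsq.
  rewrite [leRHS](bigID (fun l => l \in K))/= ler_wpDr//.
    by apply: sumr_ge0 => l _; exact: nsq_ge0.
  apply: ler_sum => l; rewrite inE => nl.
  have Sz0 : (V *m S *m z) l 0 = 0.
    rewrite mxE big1// => j _.
    by rewrite zV ?mul0r//; exact: leq_trans (ltn_ord j) nl.
  have -> : (V *m w) l 0 = (V *m g s) l 0 + (V *m m) l 0; last by [].
  by rewrite /w !mulmxDr mulmxA mxE [X in X + _]mxE Sz0 addr0 addrC.
by rewrite integral_cst//= probability_setT mule1.
Qed.

End gaussian_events.

(** * Decoupling the minimising direction *)

Section smallest_singular_value_tail.
Context d (T : measurableType d) (R : realType).
Variables (P : probability T R) (v : R).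
Hypothesis v0 : 0 < v.
Local Notation C := R[i].

Lemma cnsq_first n (w : 'cV[C]_n.+1) :
  (forall l : 'I_n.+1, (0 < l)%N -> w l 0 = 0) -> cnsq w = nsq (w 0 0).
Proof.
move=> w0; rewrite /cnsq big_ord_recl big1 ?addr0// => j _.
by rewrite w0 ?nsq0.
Qed.

Lemma small_distance_direction n' N (M : 'M[C]_(n'.+1, N))
    (G : T -> 'M[C]_(n'.+1, N)) (u : 'cV[C]_n'.+1) (x kap : R) :
  gaussian_mx P v G -> (n' <= N)%N -> 0 < x -> 0 < kap ->
  measurable [set t | exists y : 'rV[C]_n'.+1,
     rnsq (y *m (M + G t)) < x * rnsq y /\
     kap * cnsq u * rnsq y < nsq ((y *m u) 0 0)] ->
  (P [set t | exists y : 'rV[C]_n'.+1,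
     (rnsq (y *m (M + G t)) < x * rnsq y /\
     kap * cnsq u * rnsq y < nsq ((y *m u) 0 0))%R] <=
   (v^-1 ^+ (N - n') * gamma_bound (N - n') (x / kap))%:E)%E.
Proof.
move=> hG nN x0 kap0 mE.
have [V [uV hV] zV] := gaussian_QR P v0 u.
have := small_distance v0 (V *m M) (x / kap) (hV _ _ hG) nN.
apply: le_trans; apply: le_measure; rewrite ?inE//.
  apply: measurable_exists_row => [y|s].
    apply: measurable_ltr; last exact: measurable_cst.
    apply: measurable_rnsq; apply: measurable_mxM; first exact: measurable_mx_cst.
    apply: measurable_mxD; first exact: measurable_mx_cst.
    apply: measurable_mxM; first exact: measurable_mx_cst.
    exact: (gaussian_measurable_mx hG).
  apply: open_ltr; first exact: continuous_rnsq.
  by apply: continuous_cstM; apply: continuous_nsq; exact: ccontinuous_row.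
move=> t /= [y [h1 h2]]; exists (y *m V^t*).
set y' := y *m V^t*; pose r := (V *m u) 0 0.
have Vu0 (l : 'I_n'.+1) : (0 < l)%N -> (V *m u) l 0 = 0 by move=> l0; exact: zV.
have E1 : (y *m u) 0 0 = y' 0 0 * r.
  have -> : y *m u = y' *m (V *m u).
    by rewrite /y' mulmxA -(mulmxA y) unitary_trC_mul// mulmx1.
  rewrite mxE big_ord_recl big1 ?addr0// => j _.
  by rewrite Vu0 ?mulr0.
have E2 : cnsq u = nsq r by rewrite -(unitary_cnsq u uV) cnsq_first.
have -> : y' *m (V *m M + V *m G t) = y *m (M + G t).
  by rewrite /y' -mulmxDr mulmxA -(mulmxA y) unitary_trC_mul// mulmx1.
move: h2; rewrite E1 E2 nsqM => h2.
(* The strict inequality [h2] would read [0 < 0] if [u], and hence [r], were zero. *)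
have r0 : 0 < nsq r.
  rewrite lt_neqAle nsq_ge0 eq_sym nsq_eq0 andbT.
  by apply: contraTneq h2 => ->; rewrite nsq0 !mulr0 mul0r ltxx.
have h3 : kap * rnsq y < nsq (y' 0 0).
  by rewrite -(ltr_pM2r r0) -mulrA [rnsq y * _]mulrC mulrA.
apply: (lt_le_trans h1); rewrite -mulrA ler_pM2l// -ler_pdivrMl ?invr_gt0// invrK.
exact: ltW.
Qed.

(** Rotating [y^t*] to a multiple of the first basis vector turns the event into the first
    coordinate of a Gaussian vector carrying more than a share [kap] of its squared norm; that share
    has a Beta(1, n') law. *)
Lemma large_coefficient n' (g : T -> 'cV[C]_n'.+1) (y : 'rV[C]_n'.+1) (kap : R) :
  gaussian_mx P v g -> y != 0 -> 0 < kap -> kap < 1 ->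
  (((1 - kap) ^+ n')%:E <=
   P [set t | (kap * cnsq (g t) * rnsq y < nsq ((y *m g t) 0 0))%R])%E.
Proof.
move=> hg y0 kap0 kap1.
have [V [uV hV] zV] := gaussian_QR P v0 (y^t*).
(* With [S0] the squared norm of the other coordinates, [kap * (z + S0) < z] means [a * S0 < z];
   moreover [(1 + a)^-1 = 1 - kap]. *)
pose a := kap / (1 - kap).
have a0 : 0 <= a by rewrite divr_ge0; lra.
have hVg : gaussian_family P v (fun l t => (V *m g t) l 0).
  have fI : injective (fun l : 'I_n'.+1 => (l, 0 : 'I_1)) by move=> l l' [].
  exact: (gaussian_family_reindex fI (hV _ _ hg)).
pose K : {set 'I_n'.+1} := [set l : 'I_n'.+1 | l != 0]%SET.
have cK : #|K| = n'.
  by rewrite (_ : K = [set~ 0]%SET) ?cardsC1 ?card_ord//; apply/setP => l; rewrite !inE.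
have K0 : 0 \notin K by rewrite inE eqxx.
have := gaussian_large_coord v0 hVg K0 a0 (lexx 0).
rewrite cK mul0r oppr0 expR0 div1r -exprVn (_ : (1 + a)^-1 = 1 - kap); last first.
  by rewrite /a; field; rewrite subr_eq0 gt_eqF//= ; apply/eqP; lra.
move=> /le_trans; apply; rewrite le_eqVlt; apply/orP; left; apply/eqP; congr (P _).
pose r := (V *m y^t*) 0 0.
have Vu0 (l : 'I_n'.+1) : (0 < l)%N -> (V *m y^t*) l 0 = 0 by move=> l0; exact: zV.
have nsq_conj (z : C) : nsq z^*%C = nsq z by case: z => ? ?; rewrite !nsqE/= sqrrN.
have trCE (w : 'cV[C]_n'.+1) l : w^t* 0 l = (w l 0)^*%C by rewrite !mxE.
have E2 : rnsq y = nsq r.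
  rewrite -cnsq_first// unitary_cnsq// /rnsq /cnsq; apply: eq_bigr => i _.
  by rewrite !mxE conjCE nsq_conj.
have r0 : 0 < nsq r by rewrite -E2 lt_neqAle rnsq_ge0 eq_sym rnsq_eq0 y0.
have E1 t : nsq ((y *m g t) 0 0) = nsq r * nsq ((V *m g t) 0 0).
  have -> : y *m g t = (V *m y^t*)^t* *m (V *m g t).
    by rewrite trmxC_mul trmxCK mulmxA -(mulmxA y) unitary_trC_mul// mulmx1.
  rewrite mxE big_ord_recl big1 ?addr0.
    by rewrite trCE nsqM nsq_conj.
  by move=> j _; rewrite trCE Vu0// conjc0 mul0r.
have aE (S0 z : R) : (a * S0 + 0 < z) = (kap * (z + S0) < z).
  rewrite addr0 /a mulrAC ltr_pdivrMr; last lra.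
  by apply/idP/idP => h; lra.
have sK t : cnsq (g t) = nsq ((V *m g t) 0 0) + \sum_(i in K) nsq ((V *m g t) i 0).
  rewrite -(unitary_cnsq (g t) uV) /cnsq (bigD1 0)//=; congr (_ + _).
  by apply: eq_bigl => i; rewrite inE.
by apply/seteqP; split => t /=; rewrite E1 E2 sK [kap * _ * _]mulrC ltr_pM2l// aE.
Qed.

(* The first column [g] of an independent copy of [G] is independent of the
   minimising [y], so it has a large component along [y] with probability at
   least [(1 - kap)^n']. *)
Lemma smallest_gap_tail n' N (M : 'M[C]_(n'.+1, N)) (G : T -> 'M[C]_(n'.+1, N))
    (x kap : R) :
  gaussian_mx P v G -> (n' < N)%N -> 0 < x -> 0 < kap -> kap < 1 ->
  (P [set t | exists y : 'rV[C]_n'.+1, (rnsq (y *m (M + G t)) < x * rnsq y)%R] *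
     ((1 - kap) ^+ n')%:E <=
   (v^-1 ^+ (N - n') * gamma_bound (N - n') (x / kap))%:E)%E.
Proof.
move=> hG nN x0 kap0 kap1.
pose j0 : 'I_N := Ordinal (leq_ltn_trans (leq0n n') nN).
pose g t : 'cV[C]_n'.+1 := col j0 (G t).
have hg : gaussian_mx P v g.
  have fI : injective (fun l : 'I_n'.+1 * 'I_1 => (l.1, j0)).
    by move=> [l a] [l' a'] [->]; rewrite (ord1 a) (ord1 a').
  by apply: gaussian_family_ext (gaussian_family_reindex fI hG) => -[l a] s; rewrite mxE.
pose S := [set t | exists y : 'rV[C]_n'.+1, rnsq (y *m (M + G t)) < x * rnsq y].
have mMG : measurable_mx (fun t => M + G t).
  by apply: measurable_mxD; [exact: measurable_mx_cst|exact: (gaussian_measurable_mx hG)].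
have open1 t : open (@rowC R n'.+1 @^-1`
    [set y | rnsq (y *m (M + G t)) < x * rnsq y]).
  apply: open_ltr; first exact: continuous_rnsq.
  apply: continuous_cstM; have := @continuous_rnsq R n'.+1 _ 1%:M.
  by under [X in continuous X -> _]eq_fun do rewrite mulmx1.
have open2 t : open (@rowC R n'.+1 @^-1`
    [set y | kap * cnsq (g t) * rnsq y < nsq ((y *m g t) 0 0)]).
  apply: open_ltr; last by apply: continuous_nsq; exact: ccontinuous_mulmx.
  apply: continuous_cstM; have := @continuous_rnsq R n'.+1 _ 1%:M.
  by under [X in continuous X -> _]eq_fun do rewrite mulmx1.
have meas1 (y : 'rV[C]_n'.+1) : measurable [set t | rnsq (y *m (M + G t)) < x * rnsq y].
  apply: measurable_ltr; last exact: measurable_cst.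
  by apply: measurable_rnsq; apply: measurable_mxM => //; exact: measurable_mx_cst.
have meas2 (y : 'rV[C]_n'.+1) :
    measurable [set t | kap * cnsq (g t) * rnsq y < nsq ((y *m g t) 0 0)].
  apply: measurable_ltr.
    apply: measurable_funM => //; apply: measurable_funM => //.
    exact: (measurable_cnsq (gaussian_measurable_mx hg)).
  apply: measurable_nsq.
  exact: (measurable_mxM (measurable_mx_cst _) (gaussian_measurable_mx hg)).
have mS : measurable S by exact: measurable_exists_row.
pose Q := [set ts : T * T | exists y : 'rV[C]_n'.+1,
  rnsq (y *m (M + G ts.1)) < x * rnsq y /\
  kap * cnsq (g ts.2) * rnsq y < nsq ((y *m g ts.2) 0 0)].
have mQ : measurable Q.
  apply: (@measurable_exists_row R n'.+1 _ (T * T)%type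
    (fun ts y => rnsq (y *m (M + G ts.1)) < x * rnsq y /\
      kap * cnsq (g ts.2) * rnsq y < nsq ((y *m g ts.2) 0 0))) => [y|ts].
    apply: measurableI.
      by have := @measurable_fst _ _ T T measurableT _ (meas1 y); rewrite setTI; apply.
    by have := @measurable_snd _ _ T T measurableT _ (meas2 y); rewrite setTI; apply.
  by apply: openI; [exact: open1|exact: open2].
have p0 : 0 <= (1 - kap) ^+ n' by rewrite exprn_ge0// subr_ge0 ltW.
(* Lower bound on the mass of [Q], slicing at fixed [t]: for [t] in [S] a witness [y] is chosen from
   [t] alone, before the second component is drawn. *)
apply: (@le_trans _ _ ((P \x P)%E Q)).
  rewrite (_ : (P S * _)%E = (\int[P]_t ((\1_S t)%:E * ((1 - kap) ^+ n')%:E))%E); last first.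
    rewrite ge0_integralZr//; first by rewrite integral_indic// setIT.
    exact/measurable_EFinP/measurable_indic.
  apply: ge0_le_integral => //.
  - by move=> t _; rewrite mule_ge0// lee_fin// indicE.
  - apply: emeasurable_funM; last exact: measurable_cst.
    exact/measurable_EFinP/measurable_indic.
  - exact: measurable_fun_xsection.
  - move=> t _; rewrite indicE; case: (boolP (t \in S)) => [|_]; last by rewrite mul0e.
    rewrite inE mul1e => -[y hy].
    have y0 : y != 0.
      apply: contraTneq hy => ->; rewrite mul0mx -leNgt.
      by rewrite /rnsq !big1 ?mulr0// => j _; rewrite mxE nsq0.
    apply: (le_trans (large_coefficient hg y0 kap0 kap1)).
    apply: le_measure; rewrite ?inE//.
      exact: measurable_xsection.
    by move=> s hs; rewrite /xsection/= inE; exists y.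
(* Upper bound, slicing in the other order: with [s] fixed, [g s] is a deterministic direction and
   [small_distance_direction] applies. *)
have -> : (P \x P)%E Q = (P \x^ P)%E Q.
  by apply: product_measure_unique => // A B mA mB; exact: product_measure2E.
set c := (X in (_ <= X)%E).
rewrite -[leRHS](_ : (\int[P]_t cst c t)%E = c); last first.
  by rewrite integral_cst//= probability_setT mule1.
apply: ge0_le_integral => //.
- exact: measurable_fun_ysection.
move=> s _ /=.
rewrite (_ : ysection Q s = [set t | exists y : 'rV[C]_n'.+1,
     rnsq (y *m (M + G t)) < x * rnsq y /\
     kap * cnsq (g s) * rnsq y < nsq ((y *m g s) 0 0)]); last first.
  by apply/seteqP; split => t; rewrite /ysection/= inE.
apply: small_distance_direction => //; first exact: ltnW.
have := measurable_ysection s mQ.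
by congr measurable; apply/seteqP; split => t; rewrite /ysection/= inE.
Qed.

End smallest_singular_value_tail.

(** * The smallest singular value as a minimum over row vectors *)

Section singular_value.
Context (R : realType).
Local Notation C := R[i].

(** The spectral theorem for [B] turns the quadratic form of [B] at [z *m S] into a diagonal one.
    The left side is real and so are the [nsq (z 0 i)]; taking real parts of the identity therefore
    leaves only the real parts of the eigenvalues. *)
Lemma rnsq_spectral n N (A : 'M[C]_(n, N)) (z : 'rV[C]_n) :
  let B := A *m A^t* in
  rnsq (z *m spectralmx B *m A) =
  \sum_i complex.Re (spectral_diag B 0 i) * nsq (z 0 i).
Proof.
move=> B; set S := spectralmx B.
have nB : B \is normalmx.
  apply/normalmxP; rewrite /B trmxC_mul trmxCK.
  by [].
have /orthomx_spectralP BE := nB.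
have uS : S \is unitarymx by exact: spectral_unitarymx.
have SS : S *m S^t* = 1%:M by apply/unitarymxP.
have E : (rnsq (z *m S *m A))%:C%C = \sum_i spectral_diag B 0 i * (nsq (z 0 i))%:C%C.
  rewrite -rnsqE !trmxC_mul !mulmxA.
  have BE' : B = S^t* *m diag_mx (spectral_diag B) *m S by rewrite -invmx_unitary.
  have -> : z *m S *m A *m A^t* *m S^t* *m z^t* = z *m diag_mx (spectral_diag B) *m z^t*.
    rewrite -(mulmxA (z *m S) A) -/B [in LHS]BE' !mulmxA -(mulmxA z S) SS mulmx1.
    by rewrite -(mulmxA _ S) SS mulmx1.
  rewrite mxE; apply: eq_bigr => i _.
  rewrite mul_mx_diag !mxE conjCE -nsq_real; ring.
have /(congr1 (@complex.Re R)) := E; rewrite /= => ->.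
rewrite (raddf_sum (@complex.Re R)).
apply: eq_bigr => i _; case: (spectral_diag B 0 i) => a b /=; ring.
Qed.

(** If the last singular value is below [tau], an eigenvector of its eigenvalue is a witness;
    otherwise every eigenvalue is at least [tau ^+ 2]. The strict form makes the condition on [y]
    open, as the measurability argument requires. *)
Lemma singular_value_lt n' N (A : 'M[C]_(n'.+1, N)) (tau : R) : 0 < tau ->
  singular_value A n'.+1 < tau <->
  exists y : 'rV[C]_n'.+1, rnsq (y *m A) < tau ^+ 2 * rnsq y.
Proof.
move=> tau0; set B := A *m A^t*; set S := spectralmx B.
have uS : S \is unitarymx by exact: spectral_unitarymx.
have SS : S *m S^t* = 1%:M by apply/unitarymxP.
pose lam i := complex.Re (spectral_diag B 0 i).
pose s := [seq Num.sqrt (lam i) | i <- enum 'I_n'.+1].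
have szs : size (sort >=%R s) = n'.+1 by rewrite size_sort size_map size_enum_ord.
have svE : singular_value A n'.+1 = nth 0 (sort >=%R s) n' by [].
have rz z : rnsq (z *m S) = rnsq z.
  have uSt : S^t* \is unitarymx by rewrite trmxC_unitary.
  by have := unitary_rnsq z uSt; rewrite trmxCK.
split=> [|[y hy]].
  rewrite svE; have : nth 0 (sort >=%R s) n' \in s.
    by rewrite -(mem_sort >=%R) mem_nth// szs.
  move=> /mapP[i _ ->] hi.
  exists ((delta_mx 0 i : 'rV[C]_n'.+1) *m S).
  rewrite rz rnsq_spectral -/B.
  have dE j : nsq ((delta_mx 0 i : 'rV[C]_n'.+1) 0 j) = (j == i)%:R.
    by rewrite mxE eqxx/=; case: (j == i); rewrite ?nsq1 ?nsq0.
  have -> : rnsq (delta_mx 0 i : 'rV[C]_n'.+1) = 1.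
    rewrite /rnsq (bigD1 i)//= dE eqxx big1 ?addr0// => j /negbTE ji.
    by rewrite dE ji.
  rewrite (bigD1 i)//= dE eqxx big1 ?addr0; last first.
    by move=> j /negbTE ji; rewrite dE ji mulr0.
  rewrite !mulr1 -/(lam i).
  have [l0|l0] := leP 0 (lam i); last by apply: (lt_le_trans l0); rewrite sqr_ge0.
  by rewrite -(sqr_sqrtr l0) ltr_pXn2r// nnegrE ?sqrtr_ge0// ltW.
rewrite ltNge; apply/negP => hs; move: hy; apply/negP; rewrite -leNgt.
have hl i : tau ^+ 2 <= lam i.
  have si : Num.sqrt (lam i) \in sort >=%R s.
    by rewrite mem_sort; apply/mapP; exists i => //; rewrite mem_enum.
  have : tau <= Num.sqrt (lam i).
    (* The list is nonincreasing and [n'] is its last index, so the entry there is at most the one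
       for [lam i]. *)
    apply: (le_trans hs); rewrite svE -(nth_index 0 si).
    have /(sorted_leq_nth ge_trans ge_refl 0) H := sort_sorted (@ge_total _ R) s.
    apply: H; rewrite ?inE ?index_mem ?szs//.
    by move: (si); rewrite -index_mem szs ltnS.
  (* [Num.sqrt] is zero on negative reals, which [0 < tau <= Num.sqrt (lam i)] rules out. *)
  move=> h; have l0 : 0 <= lam i.
    rewrite leNgt; apply/negP => l0; move: h; rewrite ler0_sqrtr; last exact: ltW.
    by rewrite leNgt tau0.
  by rewrite -(sqr_sqrtr l0) ler_pXn2r// nnegrE ?sqrtr_ge0// ltW.
pose z := y *m S^t*.
have yE : y = z *m S by rewrite /z -mulmxA unitary_trC_mul// mulmx1.
rewrite yE rz rnsq_spectral -/B /rnsq mulr_sumr.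
by apply: ler_sum => i _; apply: ler_wpM2r; [exact: nsq_ge0|exact: hl].
Qed.

End singular_value.

(** * Stirling's lower bound for the factorial *)

Section stirling.
Context (R : realType).
Local Notation mu := (@lebesgue_measure R).

Lemma ler_mulcos_sin (x : R) : 0 <= x <= pi / 2 -> x * cos x <= sin x.
Proof.
move=> /andP[x0 xpi].
pose f (t : R) := sin t - t * cos t.
have df (t : R) : is_derive t 1 f (t * sin t).
  by apply: is_derive_eq; rewrite /GRing.scale/=; ring.
have cf : continuous f by apply: derivable_continuous.
suff : f 0 <= f x by rewrite /f sin0 mul0r subrr subr_ge0.
apply: (@ger0_derive1_le_cc _ f 0 (pi / 2)).
- by move=> t _.
- move=> t; rewrite in_itv/= => /andP[t0 tpi].
  rewrite derive1E derive_val mulr_ge0 ?(ltW t0)// sin_ge0_pi// ltW//=.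
  by have := pi_gt0 R; lra.
- exact: continuous_subspaceT.
- by rewrite in_itv/= lexx; have := pi_gt0 R; lra.
- by rewrite in_itv/= x0.
- by [].
Qed.

(* Compares the Wallis integral with a Gaussian one. *)
Lemma cos_le_expR (x : R) : - (pi / 2) <= x <= pi / 2 -> cos x <= expR (- (2^-1 * x ^+ 2)).
Proof.
wlog x0 : x / 0 <= x => [hw|].
  have [|x0] := leP 0 x; first exact: hw.
  move=> xpi; rewrite -cosN -sqrrN; apply: hw; lra.
move=> /andP[_ xpi].
pose f (t : R) := cos t * expR (2^-1 * t ^+ 2).
have df (t : R) : is_derive t 1 f ((t * cos t - sin t) * expR (2^-1 * t ^+ 2)).
  have d2 : is_derive t 1 (fun t : R => 2^-1 * t ^+ 2) t.
    by apply: is_derive_eq; rewrite /GRing.scale/=; field.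
  have d3 : is_derive t 1 (fun t : R => expR (2^-1 * t ^+ 2)) (expR (2^-1 * t ^+ 2) * t).
    by have := @is_derive1_comp R expR _ t _ _ (is_derive_expR _) d2.
  by apply: is_derive_eq; rewrite /GRing.scale/=; ring.
have cf : continuous f by apply: derivable_continuous.
suff : f x <= f 0.
  by rewrite /f cos0 expr0n/= mulr0 expR0 mulr1 expRN -ler_pdivlMr ?expR_gt0// div1r.
apply: (@ler0_derive1_le_cc _ f 0 (pi / 2)).
- by move=> t _.
- move=> t; rewrite in_itv/= => /andP[t0 tpi].
  rewrite derive1E derive_val mulr_le0_ge0 ?expR_ge0// subr_le0 ler_mulcos_sin// !ltW//.
- exact: continuous_subspaceT.
- by rewrite in_itv/= x0.
- by rewrite in_itv/= lexx; have := pi_gt0 R; lra.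
- by [].
Qed.

(** Wallis's recursion at the level of primitives: [(2k+2) F_(k+1) = (2k+1) F_k + sin * cos^(2k+1)],
    whose last term vanishes at both ends. Integration by parts thus becomes the verification of a
    derivative. *)
Lemma cos_even_primitive (k : nat) : exists F : R -> R,
  (forall x : R, is_derive x 1 F (cos x ^+ (2 * k))) /\
  F (pi / 2) - F (- (pi / 2)) = pi * ((2 * k)`!%:R / (4 ^+ k * k`!%:R ^+ 2)).
Proof.
elim: k => [|k [F [dF FE]]].
  exists id; split => [x|]; first by apply: is_derive_eq.
  by rewrite muln0 fact0 expr0 expr1n mulr1 divr1 mulr1; lra.
pose a : R := (2 * k).+1%:R; pose b : R := (2 * k).+2%:R.
have b0 : b != 0 by rewrite pnatr_eq0.
exists (fun x => b^-1 * (a * F x + sin x * cos x ^+ (2 * k).+1)); split => [x|].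
  have dc : is_derive x 1 (fun x : R => cos x ^+ (2 * k).+1)
      (- (a * cos x ^+ (2 * k) * sin x)).
    rewrite (_ : (fun x : R => _) = cos ^+ (2 * k).+1); last by rewrite exprfctE.
    apply: is_derive_eq.
    by rewrite /GRing.scale/= -/a mulrN.
  apply: is_derive_eq.
  rewrite /GRing.scale/= mulnS exprD exprS.
  have ba : b = a + 1 by rewrite /a /b natr1.
  have s2 : sin x ^+ 2 = 1 - cos x ^+ 2 by have := cos2Dsin2 x; lra.
  apply: (mulfI b0); rewrite mulVKf// ba.
  transitivity (a * cos x ^+ (2 * k) * (1 - sin x ^+ 2) + cos x ^+ 2 * cos x ^+ (2 * k)).
    by ring.
  by rewrite s2; ring.
rewrite sinN cosN !sin_pihalf cos_pihalf expr0n/= !mulr0 !addr0 -mulrBr -mulrBr FE.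
have -> : ((2 * k.+1)`! = (2 * k).+2 * (2 * k).+1 * (2 * k)`!)%N by rewrite mulnS !factS mulnA.
rewrite factS !natrM -/a -/b [4 ^+ k.+1]exprS exprMn.
have -> : b = 2 * k.+1%:R by rewrite /b -natrM mulnS.
have k0 : k.+1%:R != 0 :> R by rewrite pnatr_eq0.
have kf0 : k`!%:R != 0 :> R by rewrite pnatr_eq0 -lt0n fact_gt0.
have p40 : 4 ^+ k != 0 :> R by rewrite expf_neq0// pnatr_eq0.
by field; rewrite kf0 p40 addrC natr1 k0.
Qed.

(** The left side is [binom(2k, k) / 4^k]. Times [pi] it is the Wallis integral, which is at most
    the Gaussian integral [sqrt (pi / k)] of [exp (- k x^2)] over the line. *)
Lemma central_binomial_le (k : nat) : (0 < k)%N ->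
  (2 * k)`!%:R / (4 ^+ k * k`!%:R ^+ 2) <= (Num.sqrt (pi * k%:R))^-1 :> R.
Proof.
move=> k0; have kR : 0 < k%:R :> R by rewrite ltr0n.
have pi0 := @pi_gt0 R.
have [F [dF FE]] := cos_even_primitive k.
(* The standard deviation whose normal density is proportional to [exp (- k x^2)], the [2k]-th power
   of the bound in [cos_le_expR]. *)
pose s : R := Num.sqrt ((2 * k%:R)^-1).
have s0 : s != 0 by rewrite gt_eqF// sqrtr_gt0 invr_gt0 mulr_gt0.
have s2 : s ^+ 2 = (2 * k%:R)^-1 by rewrite sqr_sqrtr// invr_ge0 mulr_ge0// ltW.
have cc : continuous (fun x : R => cos x ^+ (2 * k)).
  move=> x; exact: (continuous_comp (@continuous_cos R x) (@exprn_continuous R _ _)).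
have FTC : (\int[mu]_(x in `[(- (pi / 2))%R, (pi / 2)%R]) (cos x ^+ (2 * k))%:E =
   (pi * ((2 * k)`!%:R / (4 ^+ k * k`!%:R ^+ 2)))%:E)%E.
  rewrite (@continuous_FTC2 _ _ F).
  - by rewrite -EFinB FE.
  - lra.
  - exact: continuous_subspaceT.
  - exact: derivable_LRcontinuous.
  - by move=> x _; rewrite derive1E derive_val.
have pk : normal_peak s = (Num.sqrt (pi / k%:R))^-1.
  by rewrite /normal_peak s2; congr (Num.sqrt _)^-1; rewrite -mulr_natr; field; rewrite gt_eqF.
have pk0 : 0 < normal_peak s by exact: normal_peak_gt0.
have : ((normal_peak s)%:E *
    \int[mu]_(x in `[(- (pi / 2))%R, (pi / 2)%R]) (cos x ^+ (2 * k))%:E <= 1)%E.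
  rewrite -(integral_normal_pdf 0 s) -ge0_integralZl//; last 3 first.
  - by apply/measurable_EFinP/measurable_funTS; exact: continuous_measurable_fun.
  - by move=> x _; rewrite lee_fin exprM exprn_ge0// sqr_ge0.
  - by rewrite lee_fin ltW.
  apply: (@le_trans _ _ (\int[mu]_(x in `[(- (pi / 2))%R, (pi / 2)%R])
      (normal_pdf 0 s x)%:E)%E).
    apply: ge0_le_integral => //.
    - by move=> x _; rewrite lee_fin mulr_ge0 ?(ltW pk0)// exprM exprn_ge0// sqr_ge0.
    - apply/measurable_EFinP/measurable_funTS/measurable_funM => //.
      exact: continuous_measurable_fun.
    - by apply/measurable_EFinP/measurable_funTS; exact: measurable_normal_pdf.
    - move=> x; rewrite /= in_itv/= => xpi.
      rewrite lee_fin normal_pdfE// ler_pM2l// /normal_fun subr0 s2.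
      have -> : - x ^+ 2 / ((2 * k%:R)^-1 *+ 2) = - (2^-1 * x ^+ 2) * (2 * k)%:R.
        by rewrite -mulr_natr natrM; field; rewrite gt_eqF.
      rewrite expRM_natr lerXn2r// ?nnegrE ?expR_ge0 ?cos_le_expR//.
      exact: cos_ge0_pihalf.
  apply: ge0_subset_integral => //.
  - by apply/measurable_EFinP; exact: measurable_normal_pdf.
  - by move=> x _; rewrite lee_fin normal_pdf_ge0.
rewrite FTC -EFinM lee_fin pk; set c := _ / _.
rewrite mulrC ler_pdivrMr ?mul1r ?sqrtr_gt0 ?divr_gt0// => h.
rewrite -[leRHS]div1r ler_pdivlMr ?sqrtr_gt0 ?mulr_gt0//.
have -> : Num.sqrt ((pi : R) * k%:R) = Num.sqrt (pi / k%:R) * k%:R :> R.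
  rewrite (_ : pi * k%:R = pi / k%:R * k%:R ^+ 2); last by field; rewrite gt_eqF.
  by rewrite sqrtrM ?divr_ge0 ?(ltW pi0) ?(ltW kR)// sqrtr_sqr ger0_norm// ltW.
have sq := sqr_sqrtr (ltW (divr_gt0 pi0 kR)).
set q := Num.sqrt (pi / k%:R) in h sq *.
have q0 : 0 < q by rewrite sqrtr_gt0 divr_gt0.
have pq : pi = q ^+ 2 * k%:R by rewrite sq divfK// gt_eqF.
rewrite -(ler_pM2l q0) mulr1; apply: le_trans h.
rewrite le_eqVlt; apply/orP; left; apply/eqP; rewrite [in RHS]pq; ring.
Qed.

(** The exponential series at [m] dominates its single term [m^m / m!]. *)
Lemma fact_ge_expn (m : nat) : (m%:R / expR 1) ^+ m <= m`!%:R :> R.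
Proof.
case: m => [|m]; first by rewrite expr0 fact0.
have := @expR_ge1Dxn R m.+1%:R m (ler0n _ _) => h.
have e1 : m.+1%:R ^+ m.+1 / m.+1`!%:R <= expR m.+1%:R :> R.
  by apply: le_trans h; rewrite lerDr.
have f0 : 0 < m.+1`!%:R :> R by rewrite ltr0n fact_gt0.
rewrite exprMn exprVn ler_pdivrMr ?exprn_gt0 ?expR_gt0// -expRM_natr mul1r mulrC.
by rewrite -ler_pdivrMr.
Qed.

Definition stirling_ratio (k : nat) : R :=
  k`!%:R / (Num.sqrt (2 * pi * k%:R) * (k%:R / expR 1) ^+ k).

(** The quotient of the two sides is exactly [sqrt (pi k) * binom(2k, k) / 4^k]. *)
Lemma stirling_ratio_double k : (0 < k)%N ->
  stirling_ratio (2 * k) <= stirling_ratio k ^+ 2.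
Proof.
move=> k0; have kR : 0 < k%:R :> R by rewrite ltr0n.
have pi0 := @pi_gt0 R.
have := central_binomial_le k0.
have e0 := @expR_gt0 R 1.
rewrite /stirling_ratio; set e := expR 1 in e0 *.
set f := k`!%:R; set g := (2 * k)`!%:R.
have f0 : 0 < f by rewrite ltr0n fact_gt0.
have g0 : 0 < g by rewrite ltr0n fact_gt0.
have kn : k%:R != 0 :> R by rewrite gt_eqF.
have en : e != 0 by rewrite gt_eqF.
set p := Num.sqrt (pi * k%:R).
have p0 : 0 < p by rewrite sqrtr_gt0 mulr_gt0.
have p2 : p ^+ 2 = pi * k%:R by rewrite sqr_sqrtr// mulr_ge0// ltW.
have -> : Num.sqrt (2 * pi * (2 * k)%:R) = 2 * p.
  rewrite natrM (_ : 2 * pi * (2 * k%:R) = 2 ^+ 2 * (pi * k%:R)); last ring.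
  by rewrite sqrtrM// sqrtr_sqr ger0_norm.
have q2 : Num.sqrt (2 * pi * k%:R) ^+ 2 = 2 * p ^+ 2.
  by rewrite sqr_sqrtr ?p2; [ring|rewrite !mulr_ge0// ltW].
rewrite [(f / _) ^+ 2]expr_div_n [(Num.sqrt _ * _) ^+ 2]exprMn q2 => h.
have -> : (2 * k)%:R / e = 2 * (k%:R / e) by rewrite natrM mulrA.
set u := k%:R / e.
have u0 : 0 < u by rewrite divr_gt0.
rewrite [(2 * u) ^+ _]exprMn exprM (_ : 2 ^+ 2 = 4 :> R); last by rewrite -natrX.
rewrite -[(u ^+ k) ^+ 2]exprM [(k * 2)%N]mulnC.
set U := u ^+ (2 * k); have U0 : 0 < U by rewrite exprn_gt0.
have q40 : 0 < 4 ^+ k :> R by rewrite exprn_gt0.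
set Q := 4 ^+ k in h q40 *.
move: h; rewrite ler_pdivrMr ?mulr_gt0 ?exprn_gt0// => h.
rewrite ler_pdivrMr ?mulr_gt0//; apply: (le_trans h).
rewrite le_eqVlt; apply/orP; left; apply/eqP; field.
by rewrite !gt_eqF.
Qed.

(* If the ratio [b] were less than 1 at [k], it would be at most [b^(2^j)] at
   [2^j k], contradicting the crude lower bound [1 / sqrt (2 pi m)] at [m]. *)
Lemma stirling_ratio_ge1 k : (0 < k)%N -> 1 <= stirling_ratio k.
Proof.
move=> k0; rewrite leNgt; apply/negP => b1.
have kR : 0 < k%:R :> R by rewrite ltr0n.
have pi0 := @pi_gt0 R.
set b := stirling_ratio k in b1.
have b0 : 0 < b.
  rewrite divr_gt0 ?ltr0n ?fact_gt0// mulr_gt0 ?sqrtr_gt0 ?mulr_gt0//.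
  by rewrite exprn_gt0// divr_gt0// expR_gt0.
have ub j : stirling_ratio (2 ^ j * k) <= b ^+ (2 ^ j).
  elim: j => [|j IH]; first by rewrite expn0 mul1n expr1.
  rewrite expnS -mulnA; apply: (le_trans (stirling_ratio_double _)).
    by rewrite muln_gt0 expn_gt0.
  rewrite [(2 * 2 ^ j)%N]mulnC exprM lerXn2r// nnegrE; last by rewrite exprn_ge0// ltW.
  by rewrite divr_ge0// mulr_ge0 ?sqrtr_ge0// exprn_ge0// divr_ge0// expR_ge0.
have lb m : (0 < m)%N -> 1 <= stirling_ratio m ^+ 2 * (2 * pi * m%:R).
  move=> m0; have mR : 0 < m%:R :> R by rewrite ltr0n.
  rewrite /stirling_ratio expr_div_n exprMn sqr_sqrtr; last by rewrite !mulr_ge0// ltW.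
  set u := (m%:R / expR 1) ^+ m.
  have u0 : 0 < u by rewrite exprn_gt0// divr_gt0// expR_gt0.
  have -> : m`!%:R ^+ 2 / (2 * pi * m%:R * u ^+ 2) * (2 * pi * m%:R) = (m`!%:R / u) ^+ 2.
    have : 0 < 2 * pi * m%:R :> R by rewrite !mulr_gt0.
    by move: (2 * pi * m%:R) => w w0; field; rewrite !gt_eqF.
  rewrite exprn_ege1// ler_pdivlMr// mul1r; exact: fact_ge_expn.
clearbody b.
pose h := b^-1 - 1.
have h0 : 0 < h by rewrite subr_gt0 invf_gt1.
(* Bernoulli's inequality [1 + m h <= (1 + h)^m], where [1 + h = b^-1]. *)
have bin m : b ^+ m * (m%:R * h) <= 1.
  have : 1 + m%:R * h <= (b^-1) ^+ m.
    elim: m => [|m IH]; first by rewrite mul0r addr0 expr0.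
    rewrite exprS (_ : b^-1 = 1 + h); last by rewrite /h; ring.
    rewrite (_ : b^-1 = 1 + h) in IH; last by rewrite /h; ring.
    apply: (le_trans _ (ler_wpM2l _ IH)); last lra.
    have m0 : 0 <= m%:R :> R by [].
    have : 0 <= m%:R * h ^+ 2 by rewrite mulr_ge0// sqr_ge0.
    rewrite -natr1; lra.
  rewrite exprVn => H.
  have bm : 0 < b ^+ m by rewrite exprn_gt0.
  have : m%:R * h <= (b ^+ m)^-1 by apply: le_trans H; rewrite lerDr.
  by move=> H1; rewrite -ler_pdivlMl// mulr1.
(* For [m = 2^j], the crude bound gives [1 <= b^(2m) * 2 pi m k] and Bernoulli gives
   [b^(2m) * (m h)^2 <= 1]. Together they bound [m h^2] by [2 pi k], which fails for large [j]. *)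
have key j : (2 ^ j)%:R * h ^+ 2 <= 2 * pi * k%:R.
  set m := (2 ^ j)%N.
  have m0 : 0 < m%:R :> R by rewrite ltr0n expn_gt0.
  have H1 : 1 <= (b ^+ m) ^+ 2 * (2 * pi * (m * k)%:R).
    have mk0 : (0 < m * k)%N by rewrite muln_gt0 k0 expn_gt0.
    apply: (le_trans (lb _ mk0)).
    rewrite ler_wpM2r ?mulr_ge0 ?(ltW pi0)// lerXn2r// ?nnegrE ?ub//.
      by rewrite divr_ge0// mulr_ge0 ?sqrtr_ge0// exprn_ge0// divr_ge0// expR_ge0.
    by rewrite exprn_ge0// ltW.
  have H2 : (b ^+ m * (m%:R * h)) ^+ 2 <= 1.
    by rewrite exprn_ile1// mulr_ge0 ?exprn_ge0 ?(ltW b0)// mulr_ge0// ltW.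
  have B0 : 0 < (b ^+ m) ^+ 2 by rewrite !exprn_gt0.
  move: H1 H2; rewrite exprMn natrM; set B := (b ^+ m) ^+ 2 in B0 *.
  move=> H1 H2; rewrite -(ler_pM2l B0) -(ler_pM2r m0).
  apply: (@le_trans _ _ 1).
    have -> : B * (m%:R * h ^+ 2) * m%:R = B * (m%:R * h) ^+ 2 by ring.
    exact: H2.
  by apply: (le_trans H1); rewrite le_eqVlt; apply/orP; left; apply/eqP; ring.
have [j hj] : exists j : nat, 2 * pi * k%:R / h ^+ 2 < j%:R.
  exists (Num.truncn (2 * pi * k%:R / h ^+ 2)).+1.
  by rewrite Num.Theory.truncnS_gt//.
have := key j; rewrite -ler_pdivlMr ?exprn_gt0// => /(lt_le_trans _).
have : j%:R < (2 ^ j)%:R :> R by rewrite ltr_nat ltn_expl.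
by move=> /(lt_trans hj) h1 /(_ _ h1); rewrite ltxx.
Qed.

Lemma fact_ge_stirling k : (0 < k)%N ->
  Num.sqrt (2 * pi * k%:R) * (k%:R / expR 1) ^+ k <= k`!%:R :> R.
Proof.
move=> k0; have := stirling_ratio_ge1 k0; rewrite /stirling_ratio.
rewrite ler_pdivlMr ?mul1r// mulr_gt0 ?sqrtr_gt0 ?exprn_gt0//.
  by rewrite !mulr_gt0 ?pi_gt0// ltr0n.
by rewrite divr_gt0 ?expR_gt0// ltr0n.
Qed.

End stirling.

(** * From the hypotheses on the entries to the explicit constant *)

(** Independence of real and imaginary parts gives the law of an entry on rectangles, hence
    identifies it with the product measure [cnormal_prob v]. *)
Lemma iid_complex_normal_gaussian_mx d (T : measurableType d) (R : realType)
    (P : probability T R) (n N : nat) (G : T -> 'M[R[i]]_(n, N)) (v : R) :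
  iid_complex_normal_matrix P G v -> gaussian_mx P v G.
Proof.
move=> [hZ hI].
have mZ ij : @measurable_fun _ _ T (RR R) setT (fun t => re_im (G t ij.1 ij.2)).
  by have [[m1 _] [m2 _] _] := hZ ij.1 ij.2; exact: measurable_fun_pair.
split=> // B mB; rewrite [LHS](hI B mB); apply: eq_bigr => ij _.
have [[m1 n1] [m2 n2] h12] := hZ ij.1 ij.2.
pose m' := measure_function_pushforward__canonical__measure_function_Measure P (mZ ij).
rewrite -[LHS]/(m' (B ij)) /cnormal_prob.
apply/esym; apply: product_measure_unique => // A1 A2 mA1 mA2.
apply: etrans (h12 A1 A2 mA1 mA2) _.
by congr (_ * _)%E; [exact: n1|exact: n2].
Qed.

Section variance_inv_n.
Context d (T : measurableType d) (R : realType).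
Variables (P : probability T R) (n' N : nat) (G : T -> 'M[R[i]]_(n'.+1, N)).
Variables (M : 'M[R[i]]_(n'.+1, N)).
Hypothesis hG : gaussian_mx P n'.+1%:R^-1 G.
Hypothesis n'N : (n' < N)%N.

Lemma measurable_gap (x : R) : measurable
  [set t | exists y : 'rV[R[i]]_n'.+1, rnsq (y *m (M + G t)) < x * rnsq y].
Proof.
have mMG : measurable_mx (fun t => M + G t).
  by apply: measurable_mxD; [exact: measurable_mx_cst|exact: (gaussian_measurable_mx hG)].
apply: measurable_exists_row => [y|s].
  apply: measurable_ltr; last exact: measurable_cst.
  by apply: measurable_rnsq; apply: measurable_mxM => //; exact: measurable_mx_cst.
apply: open_ltr; first exact: continuous_rnsq.
apply: continuous_cstM; have := @continuous_rnsq R n'.+1 _ 1%:M.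
by under [X in continuous X -> _]eq_fun do rewrite mulmx1.
Qed.

(** Here [n * N / k] is [1 / (v * kap)] for [v = 1 / n] and [kap = k / N]; [expR 1 ^+ k] bounds the
    loss [(1 - kap)^-(n-1)]. *)
Definition tail_constant (n k N : nat) : R :=
  (n%:R * N%:R / k%:R) ^+ k * expR 1 ^+ k / k`!%:R.

Lemma gap_tail_expR (x : R) : 0 < x ->
  (P [set t | exists y : 'rV[R[i]]_n'.+1, (rnsq (y *m (M + G t)) < x * rnsq y)%R] <=
   (tail_constant n'.+1 (N - n') N * x ^+ (N - n'))%:E)%E.
Proof.
move=> x0; set k := (N - n')%N; set S := [set t | _].
have k0 : (0 < k)%N by rewrite subn_gt0.
have kR : 0 < k%:R :> R by rewrite ltr0n.
have v0 : 0 < n'.+1%:R^-1 :> R by rewrite invr_gt0 ltr0n.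
have kn : k%:R != 0 :> R by rewrite gt_eqF.
have kf : k`!%:R != 0 :> R by rewrite pnatr_eq0 -lt0n fact_gt0.
have gb kap : 0 < kap -> gamma_bound k (x / kap) = (x / kap) ^+ k / k`!%:R.
  by move=> kap0; rewrite /gamma_bound leNgt divr_gt0.
have Sfin : P S \is a fin_num by apply: fin_num_measure; exact: measurable_gap.
rewrite -(fineK Sfin) lee_fin; set p := fine (P S).
have main kap : 0 < kap -> kap < 1 ->
    p * (1 - kap) ^+ n' <= n'.+1%:R ^+ k * ((x / kap) ^+ k / k`!%:R).
  move=> kap0 kap1; have := smallest_gap_tail v0 M hG n'N x0 kap0 kap1.
  by rewrite -/S -(fineK Sfin) -EFinM lee_fin invrK gb.
have e1 : 1 < expR 1 :> R by rewrite -[ltLHS]expR0 ltr_expR.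
have e0 : 0 < expR 1 :> R by exact: expR_gt0.
(* The choice [kap = k / N] minimises [kap^-k (1 - kap)^-n'], but it is 1, hence
   not allowed, when [n' = 0]. *)
have [n'0|n'0] := posnP n'.
  (* When [n' = 0] the factor [(1 - kap) ^+ n'] is [1]; the value [1 / e] makes [kap^-k] equal to
     the [e^k] of [tail_constant], where [N / k = 1]. *)
  have := main (expR 1)^-1; rewrite invr_gt0 e0 invf_lt1// e1 => /(_ isT isT).
  rewrite n'0 expr0 mulr1 invrK; move/le_trans; apply.
  rewrite /tail_constant (_ : N = k); last by rewrite /k n'0 subn0.
  rewrite mul1r divff// !expr1n !mul1r exprMn le_eqVlt; apply/orP; left; apply/eqP.
  by field.
have nR : 0 < n'%:R :> R by rewrite ltr0n.
have NR : 0 < N%:R :> R by rewrite ltr0n (leq_ltn_trans _ n'N).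
have NE : N%:R = n'%:R + k%:R :> R by rewrite -natrD subnKC// ltnW.
have kap0 : 0 < k%:R / N%:R :> R by rewrite divr_gt0.
have kap1 : k%:R / N%:R < 1 :> R by rewrite ltr_pdivrMr// mul1r NE ltrDr.
have := main _ kap0 kap1.
have -> : 1 - k%:R / N%:R = n'%:R / N%:R :> R.
  by rewrite NE; field; rewrite -NE gt_eqF.
have q0 : 0 < (n'%:R / N%:R) ^+ n' :> R by rewrite exprn_gt0// divr_gt0.
rewrite -ler_pdivlMr// => /le_trans; apply.
(* The inverse is [(1 + k / n')^n'], at most [exp (k / n')^n' = e^k]. *)
have qe : ((n'%:R / N%:R) ^+ n')^-1 <= expR 1 ^+ k :> R.
  rewrite -exprVn invf_div NE mulrDl divff ?gt_eqF//.
  rewrite -expRM_natl mulr1.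
  have -> : expR k%:R = expR (k%:R / n'%:R) ^+ n' :> R.
    by rewrite -expRM_natr divfK// gt_eqF.
  rewrite lerXn2r ?nnegrE ?expR_ge0// ?expR_ge1Dx//.
apply: (@le_trans _ _ (n'.+1%:R ^+ k * ((x / (k%:R / N%:R)) ^+ k / k`!%:R) * expR 1 ^+ k)).
  rewrite ler_wpM2l// mulr_ge0 ?exprn_ge0// divr_ge0// exprn_ge0//.
  by rewrite divr_ge0 ?divr_ge0// ltW.
rewrite /tail_constant !exprMn invf_div !exprMn le_eqVlt; apply/orP; left; apply/eqP.
by ring.
Qed.

(** The nonstrict event is the intersection of the strict ones at thresholds [tau + 1 / (m + 1)].
    Each of these bounds its probability, and the bounds converge because they are continuous in the
    threshold. *)
Lemma singular_value_tail (tau : R) : 0 < tau ->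
  (P [set t | (singular_value (M + G t) n'.+1 <= tau)%R] <=
   (tail_constant n'.+1 (N - n') N * tau ^+ (2 * (N - n')))%:E)%E.
Proof.
move=> tau0.
pose S m := [set t | exists y : 'rV[R[i]]_n'.+1,
  rnsq (y *m (M + G t)) < (tau + m.+1%:R^-1) ^+ 2 * rnsq y].
have pos m : 0 < tau + m.+1%:R^-1 :> R by rewrite addr_gt0// invr_gt0 ltr0n.
have SE : [set t | singular_value (M + G t) n'.+1 <= tau] = \bigcap_m S m.
  apply/seteqP; split => t /= h.
    move=> m _; apply/singular_value_lt => //.
    by apply: (le_lt_trans h); rewrite ltrDl invr_gt0 ltr0n.
  apply/ler_addgt0Pr => e e0.
  have [m hm] : exists m, e^-1 < m.+1%:R.
    by exists (Num.truncn e^-1); exact: Num.Theory.truncnS_gt.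
  apply: ltW; apply: (lt_trans ((iffRL (singular_value_lt _ (pos m))) (h m Logic.I))).
  by rewrite ltrD2l invf_plt ?posrE.
have mS : measurable (\bigcap_m S m).
  by apply: bigcapT_measurable => m; exact: measurable_gap.
rewrite SE; set k := (N - n')%N.
pose f (x : R) := tail_constant n'.+1 k N * x ^+ k.
have -> : tail_constant n'.+1 k N * tau ^+ (2 * k) = f (tau ^+ 2) by rewrite /f exprM.
have cf : continuous f.
  by move=> x; exact: (cvgM (cvg_cst _) (@exprn_continuous R k x)).
have Sfin : P (\bigcap_m S m) \is a fin_num by exact: fin_num_measure.
rewrite -(fineK Sfin) lee_fin; apply/ler_addgt0Pr => e e0.
have c2 : continuous (fun m : R => (tau + m) ^+ 2) by apply: derivable_continuous.
have cg : (f \o (fun m : R => (tau + m) ^+ 2)) x @[x --> (0:R)] --> f ((tau + 0) ^+ 2).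
  exact: (continuous_comp (c2 0) (cf _)).
have := cvg_comp _ _ (@cvg_harmonic R) cg.
rewrite addr0 => /cvgr_lt /(_ (f (tau ^+ 2) + e)); rewrite ltrDl => /(_ e0).
move=> /filter_ex[m /=]; rewrite /harmonic => hm.
apply: ltW; apply: le_lt_trans hm; rewrite -lee_fin fineK//.
apply: le_trans (gap_tail_expR _); last by rewrite exprn_gt0.
apply: le_measure; rewrite ?inE//; first exact: measurable_gap.
by move=> t /(_ m Logic.I).
Qed.

End variance_inv_n.

(** Stirling's bound on [1 / k!] supplies the second [e^k], the second [k^-k] and
    [1 / sqrt (2 pi k)]; the real exponent [2k + 1/2] collects all powers of [k]. *)
Lemma tail_constant_le (R : realType) (n k N : nat) : (0 < k)%N ->
  tail_constant R n k N <= (Num.sqrt (2 * pi))^-1 *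
    ((n%:R * N%:R * expR 1 ^+ 2) ^+ k / (k%:R `^ (2 * k%:R + 2^-1))).
Proof.
move=> k0; have kR : 0 < k%:R :> R by rewrite ltr0n.
have pi0 := @pi_gt0 R.
have e0 : 0 < expR 1 :> R by exact: expR_gt0.
have := fact_ge_stirling R k0.
have -> : k%:R `^ (2 * k%:R + 2^-1) = (k%:R ^+ k) ^+ 2 * Num.sqrt k%:R :> R.
  rewrite powRD; last by rewrite gt_eqF ?implybT.
  by rewrite powR12_sqrt ?(ltW kR)// -natrM powR_mulrn// -exprM mulnC.
rewrite sqrtrM; last by rewrite mulr_ge0// ltW.
rewrite /tail_constant !exprMn exprVn.
set s := Num.sqrt (2 * pi); set r := Num.sqrt k%:R; set K := k%:R ^+ k.
set E := expR 1 ^+ k; set F := k`!%:R.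
have s0 : 0 < s by rewrite sqrtr_gt0 mulr_gt0.
have r0 : 0 < r by rewrite sqrtr_gt0.
have K0 : 0 < K by rewrite exprn_gt0.
have E0 : 0 < E by rewrite exprn_gt0.
have F0 : 0 < F by rewrite ltr0n fact_gt0.
move=> h.
have hF : F^-1 <= (s * r * (K / E))^-1.
  by rewrite lef_pV2 ?posrE// !mulr_gt0// invr_gt0.
have -> : k%:R^-1 ^+ k = K^-1 :> R by rewrite /K exprVn.
have c0 : 0 <= n%:R ^+ k * N%:R ^+ k / K * E :> R.
  by rewrite mulr_ge0 ?(ltW E0)// divr_ge0 ?(ltW K0)// mulr_ge0// exprn_ge0.
apply: (le_trans (ler_wpM2l c0 hF)).
rewrite le_eqVlt; apply/orP; left; apply/eqP; field.
by rewrite !gt_eqF.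
Qed.

Theorem theoremA5 (R : realType) (d : measure_display) (T : measurableType d)
    (P : probability T R) (n N : nat) (n_ge1 : (1 <= n)%N) (le_nN : (n <= N)%N)
    (G : T -> 'M[R[i]]_(n, N))
    (hG : iid_complex_normal_matrix P G (n%:R^-1))
    (RD : 'M[R[i]]_(n, N)) (tau : R) (tau_gt0 : 0 < tau) :
  let k := (N - n + 1)%N in
  (P [set t | (singular_value (RD + G t) n <= tau)%R] <=
   (tau ^+ (2 * k) / Num.sqrt (2 * pi) *
    ((n%:R * N%:R * expR 1 ^+ 2) ^+ k /
     (k%:R `^ (2 * k%:R + 2^-1))))%:E)%E.
Proof.
case: n n_ge1 le_nN G hG RD => // n' _ n'N G /iid_complex_normal_gaussian_mx hG RD; cbv zeta.
set k := (N - n'.+1 + 1)%N.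
(* Here [n = n' + 1], so the exponent [N - n + 1] is the number of columns left after the span of
   [n'] rows. *)
have kE : k = (N - n')%N by rewrite /k addn1 subnSK.
have k0 : (0 < k)%N by rewrite /k addn1.
apply: (le_trans (singular_value_tail RD hG n'N tau_gt0)).
rewrite -kE lee_fin -mulrA mulrC ler_wpM2l ?exprn_ge0 ?(ltW tau_gt0)//.
exact: tail_constant_le.
Qed.
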